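(* Let $W$ be the Coxeter group of type $D_n$, $c=s_{n-1}s_{n-2}\cdots s_1s_0$, and let $W^{f}$ be its folding of type $B_{n-1}$ with $c^{f}=s^{f}_{n-1}s^{f}_{n-2}\cdots s^{f}_1$ and embedding $\iota:\mathbf{B}_{W^{f}}\hookrightarrow\mathbf{B}_W$. Let $p$ be an integer with $\gcd(p,2n-2)=1$ and $1\le p<2n-2$. Let $\mathbf{g}^{f}\in\mathbf{B}_{W^f}$ be a $(c^{f},p)$-conjugator such that $$\mathbf{g}^{f}\mathbf{B}(c^{f})^p(\mathbf{g}^{f})^{-1}\mathbf{B}(c^{f})^{-1}=\mathbb{X}_{J_p}=\prod^{\longleftarrow}_{(a,b)\in J_p}\mathbb{P}_{c^{f}}\big(t^{f}_{(b-1)(n-1)+a}\big).$$ Then $\mathbf{g}=\iota(\mathbf{g}^{f})$ is a positive dual $(c,p)$-conjugator, and $$\mathbf{g}\,\mathbf{B}(c)^p\,\mathbf{g}^{-1}\,\mathbf{B}(c)^{-1}=\iota\Big(\mathbf{g}^{f}\mathbf{B}(c^{f})^p(\mathbf{g}^{f})^{-1}\mathbf{B}(c^{f})^{-1}\Big)=\prod^{\longleftarrow}_{(a,b)\in J_p}\ \prod_{t\in\mathrm{Orb}_\theta\left(t^{f}_{(b-1)(n-1)+a}\right)}\mathbb{P}_c(t).$$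
   Context: General conventions: for a finite irreducible Coxeter system $(W,S)$ of rank $r$, $T_W$ is the set of reflections; $\mathbf{B}_W$ is the (Artin) braid group, with generators $\mathbf{s}$ ($s\in S$) and the braid relations; $\mathbf{s}\mapsto s$ defines a surjection to $W$, and a lift of $w\in W$ is a preimage. For $w$ with reduced word $(s_1,\ldots,s_k)$, $\mathbf{B}(w)=\mathbf{s}_1\cdots\mathbf{s}_k$. A standard Coxeter element $c$ is a product of all simple reflections, each once. Hurwitz moves on tuples in a group are $(g_1,\ldots,g_k)\mapsto(g_1,\ldots,g_{i-1},g_ig_{i+1}g_i^{-1},g_i,g_{i+2},\ldots,g_k)$ and their inverses. If $(s_1,\ldots,s_r)$ is a reduced word for $c$, then for each reflection $t$ there is a unique lift $\mathbf{B}_c(t)$ of $t$ appearing as an entry of a tuple in the Hurwitz orbit of $(\mathbf{s}_1,\ldots,\mathbf{s}_r)$ (Bessis); $\mathbb{P}_c(t)=\mathbf{B}_c(t)^2$. A $(c,p)$-conjugator in $\mathbf{B}_W$ is a lift $\mathbf{g}$ of some $g\in W$ with $gc^pg^{-1}=c$; it is a positive dual $(c,p)$-conjugator if $\mathbf{g}\mathbf{B}(c)^p\mathbf{g}^{-1}\mathbf{B}(c)^{-1}=\mathbb{P}_c(u_1)\cdots\mathbb{P}_c(u_M)$ for some reflections $u_1,\ldots,u_M$, with $M=r(p-1)/2$. Type $D_n$ and folding: $W$ has simple reflections $s_0,s_1,\ldots,s_{n-1}$, where $(s_0s_2)^3=e$, $(s_is_{i+1})^3=e$ for $1\le i\le n-2$,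 and all other pairs commute (so $s_0,s_1$ are the two fork vertices, both adjacent to $s_2$). $\theta$ is the Coxeter graph automorphism swapping $s_0$ and $s_1$ and fixing the others. $W^{f}$ is the subgroup of $W$ generated by $s_1^{f}=s_0s_1$ and $s_i^{f}=s_i$ ($2\le i\le n-1$); with these as simple reflections it is a Coxeter group of type $B_{n-1}$, with $(s_1^fs_2^f)^4=e$. Each $s^f_i$ is $s_{\mathcal{O}}=\prod_{s\in\mathcal{O}}s$ for a $\theta$-orbit $\mathcal{O}$, and $\iota:\mathbf{B}_{W^f}\hookrightarrow\mathbf{B}_W$ is the injective homomorphism sending the Artin generator of $s_{\mathcal{O}}$ to $\prod_{s\in\mathcal{O}}\mathbf{s}$ (commuting factors). As elements of $W$, $c^f=c$. Both groups have Coxeter number $2n-2$. For a reflection $t^f=ws_{\mathcal{O}}w^{-1}$ of $W^f$ (with $w\in W^f$), $\mathrm{Orb}_\theta(t^f)=\{wsw^{-1}:s\in\mathcal{O}\}$, a set of pairwise commuting reflections of $W$; the corresponding elements $\mathbb{P}_c(t)$, $t\in\mathrm{Orb}_\theta(t^f)$, commute. Grid (for $W^f$, writing $\nu=n-1$): let $(u_1,\ldots,u_{\nu^2})$ be the word $(s^f_\nu,s^f_{\nu-1},\ldots,s^f_1)$ repeated $\nu$ times, and $t^f_k=u_1\cdots u_{k-1}u_ku_{k-1}\cdots u_1$; these are all the reflections of $W^f$. Let $\mathtt{Grid}_\nu=\{(a,b):1\le a,b\le\nu\}$; the cell $(a,b)$ corresponds to $t^f_{(b-1)\nu+a}$. $\prod^{\longleftarrow}$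 over a subset of $\mathtt{Grid}_\nu$ means that factors are written from left to right in decreasing order of $(b-1)\nu+a$. If $1\le p<\nu$, for $1\le j\le(p-1)/2$ set $\eta_j=\lfloor 2\nu j/p\rfloor$, $I_j^+=\{(a,\nu-p+2j-a+1):1\le a\le\eta_j\}$, $I_j^-=\{(a,\nu-2j+1):\eta_j<a\le\nu\}$, and $J_p=\bigsqcup_{j=1}^{(p-1)/2}(I_j^+\sqcup I_j^-)$. If $\nu<p<2\nu$, let $p^*=2\nu-p$ and $J_p=\mathtt{Grid}_\nu\setminus(J_{p^*}\sqcup\{(a,1):1\le a\le\nu\})$. *)

(* Defs.v *)
From HB Require Import structures.
From mathcomp Require Import all_boot.
From mathcomp Require Import all_classical.

Set Implicit Arguments.
Unset Strict Implicit.
Unset Printing Implicit Defensive.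

Local Open Scope classical_set_scope.
Local Open Scope quotient_scope.
Local Open Scope group_scope.

(* Groups given by generators and relations.  A word is a sequence of signed
   letters: (i, false) is the generator i and (i, true) is its inverse. *)

Definition word (I : Type) := seq (I * bool).

Definition pos_word (I : Type) (w : seq I) : word I := [seq (i, false) | i <- w].

Definition inv_word (I : Type) (w : word I) : word I :=
  rev [seq (x.1, ~~ x.2) | x <- w].

Definition weval (I : Type) (G : groupType) (f : I -> G) (w : word I) : G :=
  \prod_(x <- w) (if x.2 then (f x.1)^-1 else f x.1).

Inductive pres_eq (I : Type) (R : word I -> word I -> Prop) :
    word I -> word I -> Prop :=
| pres_refl u : pres_eq R u u
| pres_sym u v : pres_eq R u v -> pres_eq R v u
| pres_trans u v w : pres_eq R u v -> pres_eq R v w -> pres_eq R u w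
| pres_cat u u' v v' :
    pres_eq R u u' -> pres_eq R v v' -> pres_eq R (u ++ v) (u' ++ v')
| pres_cancel i b : pres_eq R [:: (i, b); (i, ~~ b)] [::]
| pres_rel u v : R u v -> pres_eq R u v.

Section PresentedGroup.
Variables (I : choiceType) (R : word I -> word I -> Prop).

Definition pres_eqb : rel (word I) := fun u v => `[< pres_eq R u v >].

Lemma pres_eqb_refl : reflexive pres_eqb.
Proof. by move=> u; apply/asboolP; exact: pres_refl. Qed.

Lemma pres_eqb_sym : symmetric pres_eqb.
Proof. by move=> u v; apply/asboolP/asboolP; exact: pres_sym. Qed.

Lemma pres_eqb_trans : transitive pres_eqb.
Proof.
move=> v u w /asboolP uv /asboolP vw; apply/asboolP; exact: pres_trans uv vw.
Qed.

Canonical pres_equiv := EquivRel pres_eqb pres_eqb_refl pres_eqb_sym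
  pres_eqb_trans.

Definition pres := {eq_quot pres_equiv}.

HB.instance Definition _ := Choice.on pres.
HB.instance Definition _ := EqQuotient.on pres.

Definition pres_mul (x y : pres) : pres := \pi_pres (repr x ++ repr y).
Definition pres_one : pres := \pi_pres [::].
Definition pres_inv (x : pres) : pres := \pi_pres (inv_word (repr x)).

Definition pres_gen (i : I) : pres := \pi_pres [:: (i, false)].

Lemma pres_piP u v : \pi_pres u = \pi_pres v <-> pres_eq R u v.
Proof.
split=> [/eqP|uv]; first by rewrite piE => /asboolP.
by apply/eqP; rewrite piE; apply/asboolP.
Qed.

Lemma pres_repr u : pres_eq R (repr (\pi_pres u)) u.
Proof. by apply/pres_piP; rewrite reprK. Qed.

Lemma pres_mulE u v : pres_mul (\pi_pres u) (\pi_pres v) = \pi_pres (u ++ v).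
Proof. by apply/pres_piP; apply: pres_cat; apply: pres_repr. Qed.

Lemma pres_mul_inv_word u : pres_eq R (u ++ inv_word u) [::].
Proof.
elim: u => [|[i b] u IHu]; first exact: pres_refl.
rewrite /inv_word /= rev_cons -cats1 -/(inv_word u).
have -> : (i, b) :: u ++ inv_word u ++ [:: (i, ~~ b)] =
          [:: (i, b)] ++ (u ++ inv_word u) ++ [:: (i, ~~ b)].
  by rewrite /= -catA.
apply: pres_trans (pres_cancel R i b).
apply: (pres_cat (pres_refl R [:: (i, b)])).
exact: (pres_cat IHu (pres_refl R [:: (i, ~~ b)])).
Qed.

Lemma inv_wordK u : inv_word (inv_word u) = u :> word I.
Proof.
rewrite /inv_word map_rev revK -map_comp -[RHS]map_id.
by apply: eq_map => -[i b] /=; rewrite negbK.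
Qed.

Lemma pres_mulA : associative pres_mul.
Proof.
elim/quotW=> u; elim/quotW=> v; elim/quotW=> w.
by rewrite (pres_mulE v w) (pres_mulE u v) !pres_mulE catA.
Qed.

Lemma pres_mul1 : left_id pres_one pres_mul.
Proof. by elim/quotW=> u; rewrite pres_mulE. Qed.

Lemma pres_mul1r : right_id pres_one pres_mul.
Proof. by elim/quotW=> u; rewrite pres_mulE cats0. Qed.

Lemma pres_mulV : left_inverse pres_one pres_inv pres_mul.
Proof.
move=> x; rewrite -[X in pres_mul _ X]reprK pres_mulE; apply/pres_piP.
by rewrite -{2}[repr x]inv_wordK; exact: pres_mul_inv_word.
Qed.

Lemma pres_mulrV : right_inverse pres_one pres_inv pres_mul.
Proof.
move=> x; rewrite -[X in pres_mul X _]reprK pres_mulE; apply/pres_piP.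
exact: pres_mul_inv_word.
Qed.

HB.instance Definition _ := isGroup.Build pres
  pres_mulA pres_mul1 pres_mul1r pres_mulV pres_mulrV.

(* The homomorphism pres -> G sending the generator i to f i.  It is total as a
   function, and is this homomorphism as soon as f satisfies the relations R
   (respects_rel, pres_map_gen and pres_mapM below). *)
Definition pres_map (G : groupType) (f : I -> G) (x : pres) : G :=
  weval f (repr x).

Definition respects_rel (G : groupType) (f : I -> G) :=
  forall u v, R u v -> weval f u = weval f v.

Section Map.
Variables (G : groupType) (f : I -> G).
Hypothesis fR : respects_rel f.

Lemma weval_cat u v : weval f (u ++ v) = weval f u * weval f v.
Proof. exact: big_cat. Qed.

Lemma weval_pres_eq u v : pres_eq R u v -> weval f u = weval f v.
Proof.
elim=> {u v} [//|u v _ -> //|u v w _ -> _ -> //|u u' v v' _ + _ + |i b|u v /fR //].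
  by rewrite !weval_cat => -> ->.
by rewrite /weval big_cons big_seq1 big_nil; case: b => /=; rewrite ?mulgV ?mulVg.
Qed.

Lemma pres_map_pi u : pres_map f (\pi_pres u) = weval f u.
Proof. exact/weval_pres_eq/pres_repr. Qed.

Lemma pres_map_gen i : pres_map f (pres_gen i) = f i.
Proof. by rewrite pres_map_pi /weval big_seq1. Qed.

Lemma pres_mapM : {morph pres_map f : x y / x * y}.
Proof.
elim/quotW=> u; elim/quotW=> v; rewrite [_ * _]pres_mulE !pres_map_pi.
exact: weval_cat.
Qed.

End Map.

Lemma weval_gen u : weval pres_gen u = \pi_pres u.
Proof.
elim: u => [|[i b] u IHu]; first by rewrite /weval big_nil.
rewrite /weval big_cons -/(weval _ _) IHu /=.
have -> : (if b then (pres_gen i)^-1 else pres_gen i) = \pi_pres [:: (i, b)].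
  case: b => //; apply: (mulIg (pres_gen i)); rewrite mulVg [RHS]pres_mulE.
  by apply/esym/pres_piP; exact: (pres_cancel R i true).
exact: pres_mulE.
Qed.

Lemma respects_gen : respects_rel pres_gen.
Proof. by move=> u v uv; rewrite !weval_gen; apply/pres_piP/pres_rel. Qed.

End PresentedGroup.

Fixpoint alt (I : Type) (k : nat) (i j : I) : seq I :=
  if k is k'.+1 then i :: alt k' j i else [::].

Definition cox_rel (I : Type) (m : I -> I -> nat) (u v : word I) : Prop :=
  exists i j, u = flatten (nseq (m i j) (pos_word [:: i; j])) /\ v = [::].

Definition braid_rel (I : Type) (m : I -> I -> nat) (u v : word I) : Prop :=
  exists i j,
    u = pos_word (alt (m i j) i j) /\ v = pos_word (alt (m i j) j i).

Notation coxeter_group m := (pres (cox_rel m)).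
Notation braid_group m := (pres (braid_rel m)).
Notation simple_refl m := (@pres_gen _ (cox_rel m)).
Notation artin_gen m := (@pres_gen _ (braid_rel m)).

Inductive hurwitz_move (G : groupType) : seq G -> seq G -> Prop :=
| HurwitzMove u x y v :
    hurwitz_move (u ++ [:: x, y & v]) (u ++ [:: x * y * x^-1, x & v]).

Inductive hurwitz_equiv (G : groupType) : seq G -> seq G -> Prop :=
| hurwitz_refl u : hurwitz_equiv u u
| hurwitz_step u v w :
    hurwitz_equiv u v -> hurwitz_move v w -> hurwitz_equiv u w
| hurwitz_inv u v w :
    hurwitz_equiv u v -> hurwitz_move w v -> hurwitz_equiv u w.

(* Dual notions for a Coxeter system with Coxeter matrix m, realized in a group
   G by simple reflections s : I -> G (G may be larger than the Coxeter group,
   which is then the subgroup of G generated by the s i).  The sequence c is a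
   reduced word of a standard Coxeter element; B(c) is read off this word and B_c
   is defined from the Hurwitz orbit of the corresponding tuple. *)
Section Dual.
Variables (I : finType) (m : I -> I -> nat) (G : groupType) (s : I -> G).
Variable c : seq I.

Definition proj : braid_group m -> G := pres_map s.

Definition cox_elt : G := \prod_(i <- c) s i.

Definition braid_cox : braid_group m := \prod_(i <- c) artin_gen m i.

Definition generated : set G := range (weval s).

Definition reflection : set G :=
  [set t | exists w i, generated w /\ t = w * s i * w^-1].

(* B_c(t): by a theorem of Bessis there is exactly one such lift b when t is a
   reflection; the default value 1 is then irrelevant. *)
Definition dual_lift (t : G) : braid_group m :=
  xget 1 [set b : braid_group m | proj b = t /\
    exists2 tup, hurwitz_equiv [seq artin_gen m i | i <- c] tup & b \in tup].

Definition dual_pure (t : G) : braid_group m := dual_lift t ^+ 2.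

Definition conj_defect (p : nat) (g : braid_group m) : braid_group m :=
  g * braid_cox ^+ p * g^-1 * braid_cox^-1.

Definition is_conjugator (p : nat) (g : braid_group m) : Prop :=
  proj g * cox_elt ^+ p * (proj g)^-1 = cox_elt.

Definition is_positive_dual_conjugator (p : nat) (g : braid_group m) : Prop :=
  is_conjugator p g /\
  exists us : seq G,
    [/\ (forall u, u \in us -> reflection u),
        (2 * size us = #|I| * p.-1)%N &
        conj_defect p g = \prod_(u <- us) dual_pure u].

End Dual.

(* Type D_n, with simple reflections s_0, ..., s_(n-1), and its folding of type
   B_(n-1); the index i : 'I_n.-1 stands for s^f_(i+1). *)

Section TypeD.
Local Open Scope nat_scope.

Definition Dmat (n : nat) (i j : 'I_n) : nat :=
  let: (a, b) := (minn i j, maxn i j) in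
  if a == b then 1
  else if (a == 0) && (b == 2) || (0 < a) && (b == a.+1) then 3 else 2.

Definition Bmat (r : nat) (i j : 'I_r) : nat :=
  let: (a, b) := (minn i j, maxn i j) in
  if a == b then 1
  else if b == a.+1 then (if a == 0 then 4 else 3) else 2.

Definition theta (j : nat) : nat :=
  if j == 0 then 1 else if j == 1 then 0 else j.

(* The orbit of the index i.+1 under theta. *)
Definition theta_orbit (n : nat) (i : 'I_n.-1) : {set 'I_n} :=
  [set j : 'I_n | (j == i.+1 :> nat) || (j == theta i.+1 :> nat)].

End TypeD.

Definition fold (n : nat) (G : groupType) (f : 'I_n -> G) (i : 'I_n.-1) : G :=
  \prod_(j in theta_orbit i) f j.

Definition simpleD (n : nat) : 'I_n -> coxeter_group (@Dmat n) :=
  simple_refl (@Dmat n).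

(* W^f is the subgroup of W generated by these. *)
Definition simpleF (n : nat) : 'I_n.-1 -> coxeter_group (@Dmat n) :=
  fold (@simpleD n).

(* c = s_(n-1) ... s_1 s_0 and c^f = s^f_(n-1) ... s^f_1 *)
Definition cD (n : nat) : seq 'I_n := rev (enum 'I_n).
Definition cF (n : nat) : seq 'I_n.-1 := rev (enum 'I_n.-1).

Definition BcD (n : nat) := braid_cox (@Dmat n) (cD n).
Definition BcF (n : nat) := braid_cox (@Bmat n.-1) (cF n).
Definition PcD (n : nat) := dual_pure (@Dmat n) (@simpleD n) (cD n).
Definition PcF (n : nat) := dual_pure (@Bmat n.-1) (@simpleF n) (cF n).

Definition iota_fold (n : nat) :
    braid_group (@Bmat n.-1) -> braid_group (@Dmat n) :=
  pres_map (fold (artin_gen (@Dmat n))).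

(* The set Orb_theta(tf) does not depend on the expression w s_O w^-1 of tf; here
   it is the union over all expressions.  It has one or two elements, and the
   elements P_c(t) for t in it commute, so that the order of the factors in a
   product over this set is immaterial. *)
Definition orb_theta (n : nat) (tf : coxeter_group (@Dmat n)) :
    set (coxeter_group (@Dmat n)) :=
  [set t | exists w i, [/\ generated (@simpleF n) w,
     tf = w * simpleF i * w^-1 &
     exists2 j, j \in theta_orbit i & t = w * simpleD j * w^-1]].

(* The reflections t^f_k, for 1 <= k <= (n-1)^2. *)
Definition grid_refl (n k : nat) : coxeter_group (@Dmat n) :=
  let u := flatten (nseq n.-1 (cF n)) in
  \prod_(i <- take k u ++ rev (take k.-1 u)) simpleF i.

Definition cell_refl (n : nat) (ab : nat * nat) : coxeter_group (@Dmat n) :=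
  grid_refl n (ab.2.-1 * n.-1 + ab.1)%N.

Section J.
Local Open Scope nat_scope.

(* The cells (a, b) of the grid, in decreasing order of (b - 1) nu + a. *)
Definition grid_desc (nu : nat) : seq (nat * nat) :=
  [seq (a, b) | b <- rev (iota 1 nu), a <- rev (iota 1 nu)].

Definition eta (nu p j : nat) : nat := (2 * nu * j) %/ p.

(* Membership in I_j^+ and I_j^-; the equations for b are rearranged to avoid
   truncated subtraction. *)
Definition Iplus (nu p j : nat) (ab : nat * nat) : bool :=
  (1 <= ab.1 <= eta nu p j) && (ab.2 + p + ab.1 == nu + 2 * j + 1).

Definition Iminus (nu p j : nat) (ab : nat * nat) : bool :=
  (eta nu p j < ab.1 <= nu) && (ab.2 + 2 * j == nu + 1).

Definition Jlow (nu p : nat) (ab : nat * nat) : bool :=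
  has (fun j => Iplus nu p j ab || Iminus nu p j ab) (iota 1 (p.-1)./2).

(* The second case is meant for nu < p < 2 nu; p = nu does not occur for p
   coprime to 2 nu with nu > 1. *)
Definition J (nu p : nat) (ab : nat * nat) : bool :=
  if p < nu then Jlow nu p ab
  else [&& ab \in grid_desc nu, ~~ Jlow nu (2 * nu - p) ab & ab.2 != 1].

End J.

Definition cells (nu p : nat) : seq (nat * nat) :=
  [seq ab <- grid_desc nu | J nu p ab].

Lemma weval_pos (I : Type) (G : groupType) (f : I -> G) (w : seq I) :
  weval f (pos_word w) = \prod_(i <- w) f i.
Proof. by rewrite /weval big_map. Qed.

Section CoxeterProj.
Variables (I : choiceType) (m : I -> I -> nat).
Hypothesis m1 : forall i, m i i = 1%N.

Lemma coxeter_sq i : simple_refl m i * simple_refl m i = 1.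
Proof.
have : weval (simple_refl m) (flatten (nseq (m i i) (pos_word [:: i; i]))) =
       weval (simple_refl m) [::].
  by apply: respects_gen; exists i, i.
by rewrite m1 /= /weval !big_cons big_nil mulg1.
Qed.

Lemma coxeter_alt k i j (s := simple_refl m) :
  (\prod_(x <- alt k i j) s x) * (\prod_(x <- rev (alt k j i)) s x) =
  weval s (flatten (nseq k (pos_word [:: i; j]))).
Proof.
elim: k i j => [|k IHk] i j; first by rewrite /weval !big_nil mulg1.
rewrite [alt _ i j]/= [alt _ j i]/= rev_cons big_rcons big_cons /=.
rewrite -mulgA (mulgA (\prod_(x <- alt k j i) _)) IHk mulgA.
elim: k {IHk} => [|k IHk].
  by rewrite /= /weval !big_cons !big_nil /= !mulg1.
rewrite /= /weval !big_cons /= -/(weval _ _) in IHk *.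
by rewrite -IHk !mulgA.
Qed.

Lemma coxeter_rev (w : seq I) (s := simple_refl m) :
  (\prod_(x <- w) s x) * (\prod_(x <- rev w) s x) = 1.
Proof.
elim: w => [|i w IHw]; first by rewrite !big_nil mulg1.
rewrite rev_cons big_rcons big_cons /=.
by rewrite -mulgA (mulgA (\prod_(x <- w) _)) IHw mul1g coxeter_sq.
Qed.

Lemma simple_refl_braid : respects_rel (braid_rel m) (simple_refl m).
Proof.
move=> _ _ [i [j [-> ->]]]; rewrite !weval_pos.
apply: (mulIg (\prod_(x <- rev (alt (m i j) j i)) simple_refl m x)).
rewrite coxeter_rev coxeter_alt.
have -> : 1 = weval (simple_refl m) [::] by rewrite /weval big_nil.
by apply: respects_gen; exists i, j.
Qed.

End CoxeterProj.

Section FoldProj.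
Variables (n : nat) (G : groupType) (f : 'I_n -> G).
Hypothesis fD : respects_rel (braid_rel (@Dmat n)) f.

Let F (k : nat) : G := if insub k is Some j then f j else 1.

Let F_ord (j : 'I_n) : F j = f j.
Proof. by rewrite /F valK. Qed.

Let F_braid a b : a < n -> b < n ->
  forall (ia ib : 'I_n), ia = a :> nat -> ib = b :> nat ->
  \prod_(x <- alt (Dmat ia ib) ia ib) f x =
  \prod_(x <- alt (Dmat ia ib) ib ia) f x.
Proof.
move=> _ _ ia ib _ _; rewrite -!weval_pos; apply: fD; by exists ia, ib.
Qed.

Let F_comm a b : a < b -> b < n -> ~~ ((a == 0) && (b == 2)) ->
  ~~ ((0 < a) && (b == a.+1)) -> F a * F b = F b * F a.
Proof.
move=> ab bn h1 h2; have an := ltn_trans ab bn.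
have := @F_braid a b an bn (Ordinal an) (Ordinal bn) erefl erefl.
rewrite /Dmat /= (minn_idPl (ltnW ab)) (maxn_idPr (ltnW ab)) (ltn_eqF ab).
rewrite (negbTE h1) (negbTE h2) /= !big_cons !big_nil !mulg1.
by rewrite -(F_ord (Ordinal an)) -(F_ord (Ordinal bn)).
Qed.

Let F_braid3 a b : a < b -> b < n ->
  (a == 0) && (b == 2) || (0 < a) && (b == a.+1) ->
  F a * (F b * F a) = F b * (F a * F b).
Proof.
move=> ab bn h; have an := ltn_trans ab bn.
have := @F_braid a b an bn (Ordinal an) (Ordinal bn) erefl erefl.
rewrite /Dmat /= (minn_idPl (ltnW ab)) (maxn_idPr (ltnW ab)) (ltn_eqF ab).
rewrite h /= !big_cons !big_nil !mulg1.
by rewrite -(F_ord (Ordinal an)) -(F_ord (Ordinal bn)).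
Qed.

Lemma fold0 (i : 'I_n.-1) : i = 0 :> nat -> fold f i = F 0 * F 1.
Proof.
case: n f @F F_ord F_braid F_comm F_braid3 i => [|[|k]] g F' Fo _ _ _ i i0;
  try by case: i i0.
rewrite /fold big_mkcond !big_ord_recl big1 => [|j _]; last first.
  by rewrite inE /= i0.
by rewrite !inE /= i0 /= mulg1 -!Fo.
Qed.

Lemma foldS (i : 'I_n.-1) : 0 < i -> fold f i = F i.+1.
Proof.
move=> i0; have hi : i.+1 < n by rewrite -ltn_predRL.
rewrite /fold (big_pred1 (Ordinal hi)) ?F_ord // => [|j].
  by rewrite -(F_ord (Ordinal hi)).
rewrite inE; have -> : theta i.+1 = i.+1 by rewrite /theta eqSS (gtn_eqF i0).
by rewrite orbb.
Qed.

Lemma respects_fold : respects_rel (braid_rel (@Bmat n.-1)) (fold f).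
Proof.
have lt_ord (i : 'I_n.-1) : i.+1 < n by rewrite -ltn_predRL.
have key (i j : 'I_n.-1) : i < j ->
  \prod_(x <- alt (Bmat i j) i j) fold f x =
  \prod_(x <- alt (Bmat i j) j i) fold f x.
- move=> ij; rewrite /Bmat (minn_idPl (ltnW ij)) (maxn_idPr (ltnW ij)).
  rewrite (ltn_eqF ij); have j0 : 0 < j by exact: leq_ltn_trans ij.
  have hj := lt_ord j; rewrite /=.
  have [i0|] := posnP i; last first.
    move=> i0; case: eqP => ji /=; rewrite !big_cons !big_nil !mulg1 !foldS //.
      by rewrite F_braid3 // ?ltnS // ji eqxx orbT.
    rewrite F_comm ?ltnS //=.
    by apply/eqP => -[]; exact: ji.
  have c01 : F 0 * F 1 = F 1 * F 0 by apply: F_comm; rewrite // (ltn_trans _ hj).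
  rewrite i0; case: eqP => ji /=; rewrite !big_cons !big_nil !mulg1 ?(fold0 i0);
    rewrite !foldS //.
    rewrite ji in hj *.
    have b02 : F 0 * (F 2 * F 0) = F 2 * (F 0 * F 2) by apply: F_braid3.
    have b12 : F 1 * (F 2 * F 1) = F 2 * (F 1 * F 2) by apply: F_braid3.
    transitivity (F 0 * (F 1 * (F 2 * F 1)) * F 0 * F 2).
      by rewrite {2}c01 !mulgA.
    rewrite b12; transitivity (F 0 * F 2 * F 1 * (F 2 * (F 0 * F 2))).
      by rewrite !mulgA.
    rewrite -b02; transitivity (F 0 * F 2 * (F 1 * F 0) * F 2 * F 0).
      by rewrite !mulgA.
    rewrite -c01; transitivity (F 0 * (F 2 * F 0) * F 1 * F 2 * F 0).
      by rewrite !mulgA.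
    rewrite b02; transitivity (F 2 * F 0 * (F 2 * (F 1 * F 2)) * F 0).
      by rewrite !mulgA.
    rewrite -b12; transitivity (F 2 * (F 0 * F 1) * F 2 * (F 1 * F 0)).
      by rewrite !mulgA.
    by rewrite -c01 !mulgA.
  have j1 : 1 < j by rewrite ltn_neqAle j0 andbT eq_sym; apply/eqP.
  have hc a : a < 2 -> F a * F j.+1 = F j.+1 * F a.
    move=> a2; apply: F_comm => //; first by rewrite ltnS (leq_trans _ j0).
      by rewrite eqSS; case: (val j) j1 => [|[|?]]; rewrite ?andbF.
    rewrite eqSS negb_and; apply/orP; right.
    by rewrite gtn_eqF // (leq_trans a2).
  by rewrite -mulgA hc // !mulgA hc.
move=> _ _ [i [j [-> ->]]]; rewrite !weval_pos.
have [ij|ji|/val_inj -> //] := ltngtP i j; first exact: key.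
suff -> : Bmat i j = Bmat j i by rewrite key.
by rewrite /Bmat minnC maxnC.
Qed.

End FoldProj.

Lemma Dmat1 n (i : 'I_n) : Dmat i i = 1%N.
Proof. by rewrite /Dmat minnn maxnn eqxx. Qed.

Lemma respects_simpleD n : respects_rel (braid_rel (@Dmat n)) (@simpleD n).
Proof. exact/simple_refl_braid/Dmat1. Qed.

Lemma respects_simpleF n :
  respects_rel (braid_rel (@Bmat n.-1)) (@simpleF n).
Proof. exact/respects_fold/respects_simpleD. Qed.

Lemma iota_foldM n : {morph @iota_fold n : x y / x * y}.
Proof. exact/pres_mapM/respects_fold/respects_gen. Qed.

Lemma iota_fold_gen n (i : 'I_n.-1) :
  iota_fold (artin_gen (@Bmat n.-1) i) =
  \prod_(j in theta_orbit i) artin_gen (@Dmat n) j.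
Proof. exact/pres_map_gen/respects_fold/respects_gen. Qed.

Lemma projDM n : {morph proj (m := @Dmat n) (@simpleD n) : x y / x * y}.
Proof. exact/pres_mapM/respects_simpleD. Qed.

Lemma projFM n : {morph proj (m := @Bmat n.-1) (@simpleF n) : x y / x * y}.
Proof. exact/pres_mapM/respects_simpleF. Qed.

(* Main.v *)
(* The point is the uniqueness of the lifts B_c(t) in type D (Bessis).  Reflections
   of a Hurwitz tuple of c are encoded by roots on which the Euler form
   <(1 - c)^-1 x, y> is unitriangular, a property that Hurwitz moves (mutations)
   preserve because the form is bilinear.  Explicit lifts of all roots, conjugates
   of Birman-Ko-Lee generators along the two branches of the Dynkin diagram,
   satisfy the dual braid relation for each Euler-orthogonal pair; hence the
   entries of the Hurwitz orbit are among these lifts, and they are separated by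
   their images in the group of signed permutations.

   In type B only the existence of lifts is needed: a Hurwitz move of W^f lifts to
   a sequence of Hurwitz moves of W in which the generator of s_0 s_1 is replaced
   by its two commuting factors.  So iota(B_(c^f)(t^f)) is a product of lifts B_c(t)
   over the orbit of t^f.  The number of factors is read off from the exponent sum
   of the conjugation defect. *)

Require Import Defs.
From mathcomp Require Import all_boot.
From mathcomp Require Import all_classical.
From mathcomp Require Import zify ssralg ssrint fingroup perm generic_quotient.

Set Implicit Arguments.
Unset Strict Implicit.
Unset Printing Implicit Defensive.

Local Open Scope group_scope.

(** [dual_lift] is a choice among the lifts found in the Hurwitz orbit, so [P_c(t)] can be computed
    only once an orbit entry is known to be determined by its projection. The obstacle is that the
    orbit is not known in advance, and two arbitrary lifts satisfy no short relation. Vanishing of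
    the Euler form from left to right singles out the pairs that can be adjacent. If it also
    vanishes from right to left, the lifts commute; otherwise the two belong to a triangle
    [x y = y z = z x], whose third member is the entry that the move creates. The new root is a
    signed sum of the old ones, and its signs are harmless because only zeros of the form are ever
    used. In type B, whichever lift is chosen is an entry of some orbit tuple, so its factors in
    type D can be followed. What remains is [orb_theta], a union over all expressions [w s_O w^-1]:
    two-element orbits are recognized by the sign character and by the action of [W^f] on the pairs
    of roots [e_k + e_0], [e_k - e_0]. *)

Section BraidTriples.
Variable G : groupType.
Implicit Types x y z p q r : G.

Definition braid3 x y := x * y * x = y * x * y.

(** The relation [x y = y z = z x] of the dual (Birman-Ko-Lee) presentation in type A2: three
    factorizations of one Coxeter element. *)
Definition dual_triangle x y z := x * y = y * z /\ y * z = z * x.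

Lemma conjg_commute x y : commute x y -> x ^ y = x.
Proof. by move=> xy; rewrite conjgE xy mulKg. Qed.

Lemma commuteJ z x y : commute z x -> commute z y -> commute z (x ^ y).
Proof. by move=> zx zy; do !apply: commuteM => //; exact: commuteV. Qed.

Lemma commuteJV z x y : commute z x -> commute z y -> commute z (x ^ y^-1).
Proof. by move=> zx zy; apply: commuteJ => //; exact: commuteV. Qed.

Lemma commute_conj x y z : commute x y -> commute (x ^ z) (y ^ z).
Proof. by rewrite /commute -!conjMg => ->. Qed.

Lemma braid3_sym x y : braid3 x y -> braid3 y x.
Proof. by move/esym. Qed.

Lemma braid3_conj x y z : braid3 x y -> braid3 (x ^ z) (y ^ z).
Proof. by rewrite /braid3 -!conjMg => ->. Qed.

Lemma braid3_conjE x y : braid3 x y -> x ^ y^-1 = y ^ x.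
Proof.
move=> xy; rewrite !conjgE invgK; apply: (mulgI x); apply: (mulIg y).
by rewrite mulVKg !mulgA mulgVK.
Qed.

(** Since [p ^ q^-1 = q ^ p] and [r = r ^ p], this is the relation between [q] and [r] conjugated by
    [p]. *)
Lemma braid3_chain p q r : commute p r -> braid3 p q -> braid3 q r ->
  braid3 (p ^ q^-1) r.
Proof.
move=> pr pq qr; rewrite braid3_conjE // -(conjg_commute (commute_sym pr)).
exact: braid3_conj.
Qed.

Lemma dual_triangle_rot x y z : dual_triangle x y z -> dual_triangle y z x.
Proof. by case=> xy yz; split; rewrite // -yz. Qed.

Lemma braid3_triangle x y : braid3 x y -> dual_triangle x y (y ^ x^-1).
Proof.
move=> xy; rewrite /dual_triangle conjgE invgK !mulgA mulgVK.
by rewrite -xy mulgK.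
Qed.

Lemma dual_triangle_braid3 x y z : dual_triangle x y z -> braid3 x y.
Proof. by case=> xy yz; rewrite /braid3 xy -mulgA -yz -xy mulgA. Qed.

Lemma dual_triangle_conj x y z : dual_triangle x y z -> z = y ^ x^-1.
Proof. by case=> xy yz; rewrite conjgE invgK mulgA xy yz mulgK. Qed.

Lemma dual_triangle_conjV x y z : dual_triangle x y z -> z = x ^ y.
Proof. by case=> xy yz; rewrite conjgE xy mulKg. Qed.

(** Both sides equal [q ^ (p * r)], in which [p] and [r] may be exchanged. This makes [fork_arc]
    symmetric in the two branches of the fork. *)
Lemma chain_conj_swap p q r : commute p r -> braid3 p q -> braid3 q r ->
  r ^ (p ^ q^-1)^-1 = p ^ (r ^ q^-1)^-1.
Proof.
move=> pr pq qr; have rp := commute_sym pr; have rq := braid3_sym qr.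
rewrite (braid3_conjE (braid3_sym (braid3_chain pr pq qr))).
rewrite (braid3_conjE (braid3_sym (braid3_chain rp rq (braid3_sym pq)))).
by rewrite !braid3_conjE // -!conjgM pr.
Qed.

Lemma conjg_fix_commute x y : x ^ y = x -> commute x y.
Proof. by move=> xy; rewrite /commute conjgC xy. Qed.

Lemma braid3_invol x y : x * x = 1 -> y * y = 1 ->
  x ^ y = y ^ x -> braid3 x y.
Proof.
move=> /mulg1_eq xV /mulg1_eq yV.
by rewrite !conjgE xV yV !mulgA => /esym.
Qed.

Lemma braid3_order3 x y : x * x = 1 -> y * y = 1 ->
  braid3 x y -> (x * y) ^+ 3 = 1.
Proof.
move=> xx yy xy; rewrite !expgS expg0 mulg1 !mulgA xy.
by rewrite -!mulgA (mulgA y y) yy mul1g (mulgA x x) xx mul1g yy.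
Qed.

End BraidTriples.

(** * Birman-Ko-Lee generators *)

Section Band.
Variables (G : groupType) (f : nat -> G) (N : nat).
Hypothesis f_comm : forall i j, i.+1 < j -> commute (f i) (f j).
Hypothesis f_braid : forall i, i.+1 < N -> braid3 (f i) (f i.+1).

(* The Birman-Ko-Lee generator exchanging the strands i < j. *)
Fixpoint band_rec (i m : nat) : G :=
  if m is m'.+1 then band_rec i m' ^ (f (i + m))^-1 else f i.

Definition band (i j : nat) : G := band_rec i (j - i.+1).

Lemma band1 i : band i i.+1 = f i.
Proof. by rewrite /band subnn. Qed.

Lemma bandS i j : i < j -> band i j.+1 = band i j ^ (f j)^-1.
Proof.
move=> ij; rewrite /band subSS -[in LHS](subnSK ij) /= subnSK //.
by rewrite subnKC // ltnW.
Qed.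

Lemma band_ind (i : nat) (P : nat -> Prop) :
  P i.+1 -> (forall j, i < j -> P j -> P j.+1) -> forall j, i < j -> P j.
Proof.
move=> P1 PS; elim=> // j IHj; rewrite ltnS leq_eqVlt => /orP[/eqP <- //|ij].
exact: PS (IHj ij).
Qed.

Lemma band_prop (P : G -> Prop) (i j : nat) : i < j ->
  (forall x y, P x -> P y -> P (x ^ y^-1)) ->
  (forall k, i <= k < j -> P (f k)) -> P (band i j).
Proof.
move=> ij PJ; move: j ij; apply: band_ind => [|j ij IHj] Pf.
  by rewrite band1; apply: Pf; rewrite leqnn ltnSn.
rewrite bandS //; apply: PJ; last by apply: Pf; rewrite ltnW ?ltnSn.
by apply: IHj => k /andP[ik kj]; apply: Pf; rewrite ik ltnS ltnW.
Qed.

Lemma band_f_comm i j k : i < j -> j < k -> commute (f k) (band i j).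
Proof.
move=> ij jk; apply: (band_prop ij) => [x y|l /andP[_ lj]]; first exact: commuteJV.
by apply/commute_sym/f_comm; apply: leq_ltn_trans lj jk.
Qed.

Lemma band_disjoint i j k l : i < j -> j < k -> k < l ->
  commute (band i j) (band k l).
Proof.
move=> ij jk kl; apply: (band_prop kl) => [x y|m /andP[km _]]; first exact: commuteJV.
by apply/commute_sym/band_f_comm => //; exact: leq_trans km.
Qed.

Lemma band_split i j k : i < j -> j < k ->
  band i k = band i j ^ (band j k)^-1.
Proof.
move=> ij; move: k; apply: band_ind => [|k jk IHk].
  by rewrite band1 bandS.
rewrite bandS ?(ltn_trans ij) // IHk (bandS jk) conjJg conjVg.
by rewrite (conjg_commute (commuteV (commute_sym (band_f_comm ij jk)))).
Qed.

Lemma band_braid i j k : i < j -> j < k -> k < N.+1 ->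
  braid3 (band i j) (band j k).
Proof.
move=> ij jk; move: k jk; apply: band_ind => [|k jk IHk] kN.
  rewrite band1; move: j ij kN; apply: band_ind => [|j ij IHj] jN.
    by rewrite band1; exact: f_braid.
  rewrite bandS //; apply: braid3_chain.
  - exact/commute_sym/band_f_comm.
  - by apply: IHj; exact: ltn_trans jN.
  - exact: f_braid.
rewrite (bandS jk).
have c : commute (band i j) (f k)^-1 by apply/commuteV/commute_sym/band_f_comm.
by rewrite -(conjg_commute c); apply/braid3_conj/IHk/ltnW.
Qed.

Lemma band_triangle i j k : i < j -> j < k -> k < N.+1 ->
  dual_triangle (band i j) (band i k) (band j k).
Proof.
move=> ij jk kN; apply: dual_triangle_rot.
rewrite (band_split ij jk).
exact/braid3_triangle/braid3_sym/band_braid.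
Qed.

(** It suffices to treat one inner generator [f m] and, by induction on [j], the case [j = m + 2].
    There one conjugator, [q^-1 r^-1], carries [p] to the outer band and [r] to [q], and [p]
    commutes with [r]. *)
Lemma band_nested i j k l : i < k -> k < l -> l < j -> j < N.+1 ->
  commute (band i j) (band k l).
Proof.
move=> ik kl lj jN; apply: (band_prop kl) => [x y|m /andP[km ml]].
  exact: commuteJV.
have {k l ik kl lj km ml} [im mj] : i < m /\ m.+1 < j.
  by split; [exact: leq_trans km | exact: leq_ltn_trans lj].
move: j mj jN; apply: band_ind => [|j mj IHj] jN; last first.
  rewrite bandS; last by rewrite (ltn_trans im) // ltnW.
  apply/commute_sym/commuteJV; first exact/commute_sym/IHj/ltnW.
  exact: f_comm.
rewrite bandS ?bandS //; last exact: ltnW.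
set p := band i m; set q := f m; set r := f m.+1.
have pr : commute p r by apply/commute_sym/band_f_comm.
have qr : braid3 q r by apply: f_braid.
have e : q = r ^ (q^-1 * r^-1).
  rewrite conjgE invgM !invgK; apply: (mulIg (r * q)).
  by rewrite !mulgA !mulgVK.
by rewrite -conjgM [X in commute _ X]e; exact: commute_conj.
Qed.

End Band.

(** * Roots and the Euler form *)

Lemma map_eq_cat2 (T U : Type) (f : T -> U) (s : seq T) u g h v :
  [seq f x | x <- s] = u ++ [:: g, h & v] ->
  exists s1 x y s2, [/\ s = s1 ++ [:: x, y & s2], u = map f s1,
    g = f x, h = f y & v = map f s2].
Proof.
elim: u s => [|k u IHu] [|x s] //=.
  by case: s => [|y s] //= [<- <- <-]; exists [::], x, y, s.
by case=> <- /IHu[s1 [y [z [s2 [-> -> -> -> ->]]]]]; exists (x :: s1), y, z, s2.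
Qed.

(* The label (i, j, s) with i < j stands for the root e_j + e_i (s = true) or
   e_j - e_i (s = false) of type D, in coordinates e_0, ..., e_(n-1) such that
   s_0 is the reflection in e_1 + e_0 and s_i the reflection in
   e_i - e_(i-1). *)
Definition label : Type := (nat * nat * bool)%type.

Section EulerForm.
Local Open Scope ring_scope.

(* Twice the matrix of the Euler form <(1 - c)^-1 x, y> in the coordinates e_i,
   on which c acts by a negacyclic shift of e_1, ..., e_(n-1) and by -1 on e_0. *)
Definition euler_coef (i j : nat) : int :=
  ((j <= i)%N && ((0 < j)%N || (i == 0%N)) : nat)%:Z -
  ((0 < i)%N && (i < j)%N : nat)%:Z.

Lemma euler_coef_ge i j : (0 < j)%N -> (j <= i)%N -> euler_coef i j = 1.
Proof. by move=> j0 ji; rewrite /euler_coef ji j0 (ltnNge i j) ji andbF. Qed.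

Lemma euler_coef_lt i j : (0 < i)%N -> (i < j)%N -> euler_coef i j = -1.
Proof. by move=> i0 ij; rewrite /euler_coef (leqNgt j i) i0 ij. Qed.

Lemma euler_coef00 : euler_coef 0 0 = 1.
Proof. by []. Qed.

Lemma euler_coef0l j : (0 < j)%N -> euler_coef 0 j = 0.
Proof. by case: j. Qed.

Lemma euler_coef0r i : (0 < i)%N -> euler_coef i 0 = 0.
Proof. by case: i. Qed.

Definition sign_int (s : bool) : int := if s then 1 else -1.

Definition eulerl (i : nat) (y : label) : int :=
  euler_coef i y.1.2 + sign_int y.2 * euler_coef i y.1.1.

Definition eulerr (x : label) (k : nat) : int :=
  euler_coef x.1.2 k + sign_int x.2 * euler_coef x.1.1 k.

Definition euler (x y : label) : int :=
  eulerr x y.1.2 + sign_int y.2 * eulerr x y.1.1.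

Lemma eulerE x y : euler x y = eulerl x.1.2 y + sign_int x.2 * eulerl x.1.1 y.
Proof.
case: x y => [[i j] s] [[k l] t]; rewrite /euler /eulerl /eulerr /=.
by case: s; case: t; rewrite /sign_int; lia.
Qed.

(** The relation between roots that [z] is a signed sum of [x] and [y], stated through the form
    because labels carry no vector space structure. *)
Definition euler_span (x y z : label) : Prop :=
  exists a b : bool, forall w,
    euler w z = sign_int a * euler w x + sign_int b * euler w y /\
    euler z w = sign_int a * euler x w + sign_int b * euler y w.

Lemma euler_span_rot x y z : euler_span x y z -> euler_span y z x.
Proof.
case=> a [b ab]; exists (a == ~~ b), a => w; have [-> ->] := ab w.
by case: a b {ab} => -[]; rewrite /sign_int /=; lia.
Qed.

End EulerForm.

Ltac euler_simp := repeat match goal with |- context [euler_coef ?i ?j] =>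
  first [ rewrite euler_coef00
        | rewrite (@euler_coef0l j); [|lia]
        | rewrite (@euler_coef0r i); [|lia]
        | rewrite (@euler_coef_ge i j); [|lia|lia]
        | rewrite (@euler_coef_lt i j); [|lia|lia] ] end.

(* The noncrossing subsystems of type A2, ordered so that the product of two
   consecutive reflections is below c in the absolute order. *)
Inductive label_triangle : label -> label -> label -> Prop :=
| LabelTriangle1 i j k s : i < j -> j < k -> (i == 0%N) || ~~ s ->
    label_triangle (i, j, s) (i, k, s) (j, k, false)
| LabelTriangle2 j k s : 0 < j -> j < k ->
    label_triangle (0, k, s) (0, j, ~~ s) (j, k, true)
| LabelTriangle3 i j k : 0 < i -> i < j -> j < k ->
    label_triangle (j, k, false) (i, j, true) (i, k, true)
| LabelTriangle4 i j k : 0 < i -> i < j -> j < k ->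
    label_triangle (j, k, true) (i, j, false) (i, k, true).

(* Up to exchanging x and y, the noncrossing pairs of orthogonal roots. *)
Definition label_comm (x y : label) : bool :=
  let: (i, j, s) := x in let: (k, l, t) := y in
  [|| [&& (i == 0) || ~~ s, ~~ t & (j < k) || (i < k) && (l < j)],
      [&& 0 < i, s, ~~ t, 0 < k & [|| l < i, j < k | (i < k) && (l < j)]],
      [&& 0 < i, s, k == 0, i < l & l < j],
      [&& 0 < i, s, t, i < k & l < j] |
      [&& i == 0, k == 0, j == l, s & ~~ t]].

Definition label_wf (M : nat) (x : label) : bool := x.1.1 < x.1.2 <= M.

Lemma label_triangle_euler x y z : label_triangle x y z ->
  [/\ euler x y = 0%Z, euler y z = 0%Z, euler z x = 0%Z & euler_span x y z].
Proof.
case=> [i j k s ij jk is0|j k s j0 jk|i j k i0 ij jk|i j k i0 ij jk].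
- split; try by case: s is0; rewrite /euler /eulerr /sign_int /euler_coef /=; lia.
  exists false, true => w.
  by rewrite ![euler _ w]eulerE /euler /=; case: s {is0}; rewrite /sign_int; split; lia.
- split; try by case: s; rewrite /euler /eulerr /sign_int /euler_coef /=; lia.
  exists true, true => w.
  by rewrite ![euler _ w]eulerE /euler /=; case: s; rewrite /sign_int /=; split; lia.
- split; try by rewrite /euler /eulerr /sign_int /euler_coef /=; lia.
  exists true, true => w.
  by rewrite ![euler _ w]eulerE /euler /= /sign_int; split; lia.
- split; try by rewrite /euler /eulerr /sign_int /euler_coef /=; lia.
  exists true, false => w.
  by rewrite ![euler _ w]eulerE /euler /= /sign_int; split; lia.
Qed.

(** The labels of a triangle join three indices two by two, so any two of them bound all three
    indices. This keeps a label created by a Hurwitz move in range. *)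
Lemma label_triangle_wf M x y z : label_triangle x y z ->
  [|| label_wf M x && label_wf M y, label_wf M y && label_wf M z |
      label_wf M z && label_wf M x] =
  [&& label_wf M x, label_wf M y & label_wf M z].
Proof. by rewrite /label_wf; case=> /= *; lia. Qed.

Lemma label_comm_euler x y : x.1.1 < x.1.2 -> y.1.1 < y.1.2 -> label_comm x y ->
  euler x y = 0%Z /\ euler y x = 0%Z.
Proof.
case: x y => [[i j] s] [[k l] t] /= ij kl.
rewrite /euler /eulerr /sign_int /=.
case/orP => [/and3P[is0 /negbTE -> H]|].
  case/orP: H => [jk|/andP[ik lj]]; case/orP: is0 => [/eqP ->|/negbTE ->];
    try (have [-> | i0] := posnP i); euler_simp; by case: s.
case/or4P => [/and5P[i0 -> /negbTE -> k0 /or3P[li|jk|/andP[ik lj]]]|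
  /and5P[i0 -> /eqP -> il lj]|/and5P[i0 -> -> ik lj]|
  /and5P[/eqP -> /eqP -> /eqP <- -> /negbTE ->]]; by euler_simp; case: t.
Qed.

Ltac find_triangle := apply: Or33; eexists;
  (apply: Or31 + apply: Or32 + apply: Or33);
  (apply: LabelTriangle1 + apply: (@LabelTriangle2 _ _ true) +
   apply: (@LabelTriangle2 _ _ false) + apply: LabelTriangle3 +
   apply: LabelTriangle4); solve [done | lia].

(* Orthogonality for the Euler form, for roots: either the reflections generate
   a noncrossing subsystem of type A1 x A1, or one of type A2. *)
Lemma euler0_cases x y :
  x.1.1 < x.1.2 -> y.1.1 < y.1.2 -> euler x y = 0%Z ->
  [\/ label_comm x y, label_comm y x |
     exists z, [\/ label_triangle x y z, label_triangle y z x | label_triangle z x y]].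
Proof.
case: x y => [[i j] s] [[k l] t] /= ij kl; rewrite /euler /eulerr /=.
have [i0|i0] := posnP i; have [k0|k0] := posnP k.
(* The relative order of the endpoints and the two signs fix every coefficient of the form. The
   hypothesis then is either a false equation between numerals or trivial, and the configuration
   itself tells which alternative holds. *)
all: case: (ltngtP i k) => [ik|ki|ik]; try (abstract lia).
all: case: (ltngtP j l) => [jl|lj|jl]; try (abstract lia).
all: case: (ltngtP i l) => [il|li|il]; try (abstract lia).
all: case: (ltngtP j k) => [jk|kj|jk]; try (abstract lia).
all: try subst i; try subst k; try subst j; try subst l.
all: case: s; case: t.
all: rewrite /sign_int; euler_simp; first [abstract discriminate | move=> _].
all: first [ abstract (apply: Or31; rewrite /label_comm; lia)
           | abstract (apply: Or32; rewrite /label_comm; lia)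
           | abstract find_triangle ].
Qed.

(** * Dual braid relations in type D *)

Section ForkBand.
Variables (G : groupType) (g0 : G) (f : nat -> G) (M : nat).
Hypothesis f_comm : forall i j, i.+1 < j -> commute (f i) (f j).
Hypothesis f_braid : forall i, i.+1 < M -> braid3 (f i) (f i.+1).
Hypothesis g0_comm0 : commute g0 (f 0).
Hypothesis g0_comm : forall j, 1 < j -> commute g0 (f j).
Hypothesis g0_braid : 1 < M -> braid3 g0 (f 1).

(* The two chains of the fork: s_0, s_2, s_3, ... and s_1, s_2, s_3, ... *)
Definition chain (s : bool) (i : nat) : G := if s && (i == 0) then g0 else f i.

Let chain_comm s i j : i.+1 < j -> commute (chain s i) (chain s j).
Proof.
case: j => // j; rewrite ltnS /chain andbF => ij.
case: ifP => [/andP[_ /eqP i0]|_]; last exact: f_comm.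
by apply: g0_comm; rewrite i0 in ij.
Qed.

Let chain_braid s i : i.+1 < M -> braid3 (chain s i) (chain s i.+1).
Proof.
rewrite /chain andbF => iM.
case: ifP => [/andP[_ /eqP i0]|_]; last exact: f_braid.
by rewrite i0 in iM *; exact: g0_braid.
Qed.

Definition spoke (s : bool) (j : nat) : G := band (chain s) 0 j.

Let band_chain s i j : 0 < i -> i < j -> band (chain s) i j = band f i j.
Proof.
move=> i0; have chainE k : 0 < k -> chain s k = f k.
  by case: k => // k _; rewrite /chain andbF.
move: j; apply: band_ind => [|j ij IHj]; first by rewrite !band1 chainE.
by rewrite !bandS // IHj chainE // (leq_trans i0) // ltnW.
Qed.

Lemma spoke_triangle s j k : 0 < j -> j < k <= M ->
  dual_triangle (spoke s j) (spoke s k) (band f j k).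
Proof.
move=> j0 /andP[jk kM]; rewrite -(band_chain s) //.
exact: (band_triangle (chain_comm s) (chain_braid s)).
Qed.

Lemma spoke_braid s j k : 0 < j -> j < k <= M -> braid3 (spoke s j) (band f j k).
Proof.
move=> j0 /andP[jk kM]; rewrite -(band_chain s) //.
exact: (band_braid (chain_comm s) (chain_braid s)).
Qed.

Lemma spoke_disjoint s j k l : 0 < j -> j < k -> k < l ->
  commute (spoke s j) (band f k l).
Proof.
move=> j0 jk kl; rewrite -(band_chain s) //.
  exact: (band_disjoint (chain_comm s)).
exact: ltn_trans jk.
Qed.

Lemma spoke_nested s j k l : 0 < k -> k < l -> l < j <= M ->
  commute (spoke s j) (band f k l).
Proof.
move=> k0 kl /andP[lj jM]; rewrite -(band_chain s) //.
exact: (band_nested (chain_comm s) (chain_braid s)).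
Qed.

Lemma spoke_comm s j : 0 < j -> commute (spoke s j) (spoke (~~ s) j).
Proof.
move: j; apply: band_ind => [|j j0 IHj].
  by rewrite /spoke !band1; case: s; [|apply: commute_sym]; exact: g0_comm0.
rewrite /spoke !bandS //; have -> : chain (~~ s) j = chain s j.
  by rewrite /chain (gtn_eqF j0) !andbF.
exact: commute_conj.
Qed.

(** A lift of [e_j + e_i]: the reflection in [e_j + e_0] carries [e_i - e_0] to [e_j + e_i]. *)
Definition fork_arc (i j : nat) : G := spoke false i ^ (spoke true j)^-1.

Lemma spoke_split s j k : 0 < j -> j < k <= M ->
  spoke s k = spoke s j ^ (band f j k)^-1.
Proof.
move=> j0 jk.
exact/dual_triangle_conj/dual_triangle_rot/dual_triangle_rot/spoke_triangle.
Qed.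

(** Splitting the longer spoke at [i] leaves the A3 chain [spoke true i], [band f i j],
    [spoke false i], to which [chain_conj_swap] applies. *)
Lemma fork_arc_swap s i j : 0 < i -> i < j <= M ->
  fork_arc i j = spoke (~~ s) i ^ (spoke s j)^-1.
Proof.
move=> i0 ij; case: s => //; rewrite /fork_arc !(spoke_split _ i0 ij).
by apply: chain_conj_swap; [exact: (spoke_comm true) | | apply: braid3_sym];
  exact: spoke_braid.
Qed.

Lemma fork_arc_spoke_triangle s i j : 0 < i -> i < j <= M ->
  dual_triangle (spoke s j) (spoke (~~ s) i) (fork_arc i j).
Proof.
move=> i0 ij; rewrite (fork_arc_swap s) //; apply: braid3_triangle.
rewrite (spoke_split s i0 ij); apply: braid3_chain.
- exact: spoke_comm.
- exact: spoke_braid.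
- by apply: braid3_sym; exact: spoke_braid.
Qed.

Lemma fork_arcE s i j : 0 < i -> i < j <= M ->
  fork_arc i j = spoke s j ^ spoke (~~ s) i.
Proof. by move=> i0 ij; exact/dual_triangle_conjV/fork_arc_spoke_triangle. Qed.

(** Undoing a conjugation by [spoke (~~ s) i] and then one by [spoke s k] reduces the claim to
    [band f k j] commuting with [spoke (~~ s) i], which are disjoint. *)
Lemma fork_arc_spoke_comm s i j k : 0 < i -> i < k -> k < j <= M ->
  commute (fork_arc i j) (spoke s k).
Proof.
move=> i0 ik kj; have [kjl jM] := andP kj; have k0 : 0 < k by exact: ltn_trans ik.
have ik' : i < k <= M by rewrite ik ltnW // (leq_trans kjl).
rewrite (fork_arcE s) ?(ltn_trans ik) //.
have br := dual_triangle_braid3 (fork_arc_spoke_triangle s i0 ik').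
rewrite -(conjgKV (spoke (~~ s) i) (spoke s k)) (braid3_conjE br).
apply: commute_conj; rewrite -(conjgKV (spoke s k) (spoke s j)).
rewrite -(dual_triangle_conj (spoke_triangle s k0 kj)).
exact/commute_conj/commute_sym/spoke_disjoint.
Qed.

Lemma fork_arc_band_left i j k l : 0 < k -> k < l -> l < i -> i < j <= M ->
  commute (fork_arc i j) (band f k l).
Proof.
move=> k0 kl li /andP[ij jM].
by apply: commute_sym; apply: commuteJV; apply: commute_sym; apply: spoke_nested; lia.
Qed.

Lemma fork_arc_band_right i j k l : 0 < i -> i < j -> j < k -> k < l ->
  commute (fork_arc i j) (band f k l).
Proof.
move=> i0 ij jk kl.
by apply: commute_sym; apply: commuteJV; apply: commute_sym; apply: spoke_disjoint; lia.
Qed.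

Lemma fork_arc_band_inside i j k l : 0 < i -> i < k -> k < l -> l < j <= M ->
  commute (fork_arc i j) (band f k l).
Proof.
move=> i0 ik kl lj; apply: commute_sym; apply: commuteJV; apply: commute_sym.
  exact: spoke_disjoint.
by apply: spoke_nested; lia.
Qed.

Lemma fork_arc_nested i j k l : 0 < i -> i < k -> k < l -> l < j <= M ->
  commute (fork_arc i j) (fork_arc k l).
Proof.
move=> i0 ik kl lj; have [lj' jM] := andP lj.
by apply: commuteJV; apply: fork_arc_spoke_comm; lia.
Qed.

Lemma fork_arc_triangle_right i j k : 0 < i -> i < j -> j < k <= M ->
  dual_triangle (band f j k) (fork_arc i j) (fork_arc i k).
Proof.
move=> i0 ij jk; have [jk' kM] := andP jk; have j0 := ltn_trans i0 ij.
have ij' : i < j <= M by rewrite ij ltnW // (leq_trans jk').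
have ik' : i < k <= M by rewrite (ltn_trans ij).
have c : band f j k ^ spoke false i = band f j k.
  by apply/conjg_commute/commute_sym/spoke_disjoint.
have -> : fork_arc i k = fork_arc i j ^ (band f j k)^-1.
  rewrite !(fork_arcE true) //= (spoke_split true j0 jk) conjJg conjVg.
  by rewrite c.
apply: braid3_triangle; rewrite (fork_arcE true) //= -c.
by apply/braid3_conj/braid3_sym/spoke_braid.
Qed.

Lemma fork_arc_triangle_left i j k : 0 < i -> i < j -> j < k <= M ->
  dual_triangle (fork_arc j k) (band f i j) (fork_arc i k).
Proof.
move=> i0 ij jk; have [jk' kM] := andP jk; have j0 := ltn_trans i0 ij.
have ij' : i < j <= M by rewrite ij ltnW // (leq_trans jk').
have c : band f i j ^ (spoke true k)^-1 = band f i j.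
  by apply/conjg_commute/commuteV/commute_sym/spoke_nested => //; rewrite jk'.
have -> : fork_arc i k = fork_arc j k ^ band f i j.
  have tri := dual_triangle_rot (spoke_triangle false i0 ij').
  rewrite /fork_arc (dual_triangle_conjV tri).
  by rewrite conjJg c.
have br : braid3 (fork_arc j k) (band f i j).
  rewrite /fork_arc -c; apply: braid3_conj.
  exact/(dual_triangle_braid3 (dual_triangle_rot (spoke_triangle false i0 ij'))).
by rewrite -(braid3_conjE (braid3_sym br)); exact: braid3_triangle.
Qed.

Definition label_lift (x : label) : G :=
  let: (i, j, s) := x in
  if i == 0 then spoke s j else if s then fork_arc i j else band f i j.

Lemma label_lift_comm x y : label_wf M x -> label_wf M y -> label_comm x y ->
  commute (label_lift x) (label_lift y).
Proof.
case: x y => [[i j] s] [[k l] t]; rewrite /label_wf /= => ij kl.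
case/orP => [/and3P[is0 /negbTE -> H]|].
  have k0 : 0 < k by case/orP: H; lia.
  rewrite (gtn_eqF k0).
  case: posnP is0 => [i0 _|i0 /= /negbTE ->].
    case/orP: H => [jk|/andP[ik lj]].
      by apply: spoke_disjoint => //; lia.
    by apply: spoke_nested; lia.
  by case/orP: H => [jk|/andP[ik lj]];
    [apply: (band_disjoint f_comm) | apply: (band_nested f_comm f_braid)]; lia.
case/or4P => [/and5P[i0 -> /negbTE -> k0 H]|/and5P[i0 -> /eqP -> il lj]|
  /and5P[i0 -> -> ik lj]|/and5P[/eqP -> /eqP -> /eqP <- -> /negbTE ->]].
- rewrite (gtn_eqF i0) (gtn_eqF k0); case/or3P: H => [li|jk|/andP[ik lj]].
  + by apply: fork_arc_band_left; lia.
  + by apply: fork_arc_band_right; lia.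
  + by apply: fork_arc_band_inside; lia.
- by rewrite (gtn_eqF i0); apply: fork_arc_spoke_comm; lia.
- by rewrite (gtn_eqF i0) gtn_eqF; [apply: fork_arc_nested; lia | lia].
- by apply: (spoke_comm true); lia.
Qed.

Lemma label_lift_triangle x y z : label_triangle x y z ->
  label_wf M x -> label_wf M y -> label_wf M z ->
  dual_triangle (label_lift x) (label_lift y) (label_lift z).
Proof.
rewrite /label_wf.
case=> [i j k s ij jk|j k s j0 jk|i j k i0 ij jk|i j k i0 ij jk] /=.
- case: posnP => [-> _|i0 /= /negbTE ->] x_wf y_wf z_wf.
    by rewrite gtn_eqF; [apply: spoke_triangle; lia | lia].
  by rewrite gtn_eqF; [apply: (band_triangle f_comm f_braid); lia | lia].
- by rewrite (gtn_eqF j0) => *; apply: fork_arc_spoke_triangle; lia.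
- by rewrite !gtn_eqF; [|lia|lia] => *; apply: fork_arc_triangle_right; lia.
- by rewrite !gtn_eqF; [|lia|lia] => *; apply: fork_arc_triangle_left; lia.
Qed.

Lemma label_lift_cases x y :
  label_wf M x -> label_wf M y -> euler x y = 0%Z ->
  commute (label_lift x) (label_lift y) /\ euler y x = 0%Z \/
  exists z, [/\ label_wf M z, euler y z = 0%Z, euler z x = 0%Z, euler_span x y z &
    dual_triangle (label_lift x) (label_lift y) (label_lift z)].
Proof.
move=> wx wy xy; have [/andP[lx _] /andP[ly _]] := (wx, wy).
case: (euler0_cases lx ly xy) => [c|c|[z tz]].
- left; split; first exact: label_lift_comm.
  by have [] := label_comm_euler lx ly c.
- left; split; first exact/commute_sym/label_lift_comm.
  by have [] := label_comm_euler ly lx c.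
right; exists z; case: tz => tz.
- have wz : label_wf M z 
    by have := label_triangle_wf M tz; rewrite wx wy; case: (label_wf M z).
  have [_ yz zx sp] := label_triangle_euler tz; split=> //.
  exact: label_lift_triangle.
- have wz : label_wf M z 
    by have := label_triangle_wf M tz; rewrite wx wy; case: (label_wf M z).
  have [yz zx _ sp] := label_triangle_euler tz.
  split=> //; first exact/euler_span_rot/euler_span_rot.
  exact/dual_triangle_rot/dual_triangle_rot/label_lift_triangle.
- have wz : label_wf M z 
    by have := label_triangle_wf M tz; rewrite wx wy; case: (label_wf M z).
  have [zx _ yz sp] := label_triangle_euler tz.
  split=> //; first exact/euler_span_rot.
  exact/dual_triangle_rot/label_lift_triangle.
Qed.

(** Named after exceptional sequences of quiver representations. The form vanishes from earlier to
    later entries only; its diagonal value on a root is always 2 in this normalization. *)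
Definition exceptional (L : seq label) : bool :=
  all (label_wf M) L && pairwise (fun x y => euler x y == 0%Z) L.

Lemma exceptional_cat2 L1 x y L2 :
  exceptional (L1 ++ [:: x, y & L2]) =
  [&& exceptional (L1 ++ L2), label_wf M x, label_wf M y, euler x y == 0%Z,
      all (fun w => (euler w x == 0%Z) && (euler w y == 0%Z)) L1 &
      all (fun w => (euler x w == 0%Z) && (euler y w == 0%Z)) L2].
Proof.
rewrite /exceptional !all_cat !pairwise_cat /= !allrel_consr !all_predI.
by apply/idP/idP; rewrite -!andbA; (do !case/andP=> ->); move=> ->; rewrite ?andbT.
Qed.

(** Weaker than [euler_span], so that it also covers the swap of two commuting entries, where
    [z = y]. *)
Definition euler_orth (x y z : label) : Prop := forall w,
  (euler w x = 0%Z -> euler w y = 0%Z -> euler w z = 0%Z) /\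
  (euler x w = 0%Z -> euler y w = 0%Z -> euler z w = 0%Z).

Lemma euler_span_orth x y z : euler_span x y z -> euler_orth x y z.
Proof.
case=> a [b ab] w; have [-> ->] := ab w.
by split=> -> ->; case: a b {ab} => -[].
Qed.

Lemma exceptional_mutate L1 x y z L2 : exceptional (L1 ++ [:: x, y & L2]) ->
  label_wf M z -> euler z x = 0%Z -> euler_orth x y z ->
  exceptional (L1 ++ [:: z, x & L2]).
Proof.
rewrite !exceptional_cat2 => /and5P[-> -> wy _ /andP[a1 a2]] -> -> xyz.
rewrite eqxx /=; apply/andP; split.
  by apply: sub_all a1 => w /andP[/eqP wx /eqP wy']; rewrite wx (xyz w).1.
by apply: sub_all a2 => w /andP[/eqP wx /eqP wy']; rewrite wx (xyz w).2.
Qed.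

Lemma exceptional_mutateV L1 x y z L2 : exceptional (L1 ++ [:: z, x & L2]) ->
  label_wf M y -> euler x y = 0%Z -> euler_orth z x y ->
  exceptional (L1 ++ [:: x, y & L2]).
Proof.
rewrite !exceptional_cat2 => /and5P[-> wz -> _ /andP[a1 a2]] -> -> zxy.
rewrite eqxx /=; apply/andP; split.
  by apply: sub_all a1 => w /andP[/eqP wz' /eqP wx]; rewrite wx (zxy w).1.
by apply: sub_all a2 => w /andP[/eqP wz' /eqP wx]; rewrite wx (zxy w).2.
Qed.

(** In a triangle, [x y = z x] shows that the move replaces the lifts of [x], [y] by those of [z],
    [x]. The inverse move starts from a pair [z], [x] and produces [y] from [z x = x y]. Commuting
    lifts are merely exchanged. *)
Lemma hurwitz_exceptional (L : seq label) (tup : seq G) : exceptional L ->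
  hurwitz_equiv [seq label_lift x | x <- L] tup ->
  exists2 L', exceptional L' & tup = [seq label_lift x | x <- L'].
Proof.
move=> L_exc; move eqt: [seq label_lift x | x <- L] => t0 ht.
elim: ht eqt => {t0 tup} [t <-|t u v _ IH uv e|t u v _ IH vu e]; first by exists L.
- case: uv (IH e) => {t u v IH e} u g h v [L' L'_exc e].
  have [L1 [x [y [L2 [{}e -> -> -> ->]]]]] := map_eq_cat2 (esym e).
  rewrite e in L'_exc.
  have := L'_exc; rewrite exceptional_cat2 => /and5P[_ wx wy /eqP xy _].
  case: (label_lift_cases wx wy xy) => [[c yx]|[z [wz yz zx sp [t1 t2]]]].
    exists (L1 ++ [:: y, x & L2]); last by rewrite map_cat /= c mulgK.
    exact: exceptional_mutate L'_exc wy yx _.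
  exists (L1 ++ [:: z, x & L2]); last by rewrite map_cat /= t1 t2 mulgK.
  exact: exceptional_mutate L'_exc wz zx (euler_span_orth sp).
have {IH} := IH e; case: vu => {t u v e} u g h v [L' L'_exc e].
have [L1 [z [x [L2 [{}e -> gh hx ->]]]]] := map_eq_cat2 (esym e).
rewrite e in L'_exc.
have := L'_exc; rewrite exceptional_cat2 => /and5P[_ wz wx /eqP zx _].
have {}gh : label_lift z * g = g * h by rewrite -gh mulgVK.
rewrite hx in gh *.
case: (label_lift_cases wz wx zx) => [[c xz]|[y [wy xy yz sp [t1 t2]]]].
  exists (L1 ++ [:: x, z & L2]); last first.
    by rewrite map_cat /=; congr (_ ++ [:: _, _ & _]);
      apply: (mulgI (label_lift x)); rewrite -gh c.
  exact: exceptional_mutateV L'_exc wz xz _.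
exists (L1 ++ [:: x, y & L2]); last first.
  by rewrite map_cat /=; congr (_ ++ [:: _, _ & _]);
      apply: (mulgI (label_lift x)); rewrite -gh t1.
exact: exceptional_mutateV L'_exc wy xy (euler_span_orth sp).
Qed.
End ForkBand.

(** * Signed permutations *)

Section SignedPermutations.
Variable M : nat.

Definition signed_point : finType := ('I_M.+1 * bool)%type.
Definition pt (k : nat) (s : bool) : signed_point := (inord k, s).
Definition neg (z : signed_point) : signed_point := (z.1, ~~ z.2).

Definition refl2 (u v : signed_point) : {perm signed_point} :=
  tperm u v * tperm (neg u) (neg v).

Lemma negK : involutive neg.
Proof. by case=> k s; rewrite /neg /= negbK. Qed.

Lemma neg_neq z : neg z != z.
Proof. by case: z => k s; rewrite /neg xpair_eqE eqxx /=; case: s. Qed.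

Lemma point_neq (u v : signed_point) : u.1 != v.1 -> u != v.
Proof. by apply: contraNneq => ->. Qed.

Lemma tperm_neg (u v z : signed_point) :
  tperm (neg u) (neg v) (neg z) = neg (tperm u v z).
Proof. by rewrite inj_tperm //; exact: can_inj negK. Qed.

Lemma refl2C u v : refl2 u v = refl2 v u.
Proof. by rewrite /refl2 tpermC (tpermC (neg u)). Qed.

Lemma refl2N u v : u.1 != v.1 -> refl2 (neg u) (neg v) = refl2 u v.
Proof.
move=> uv; have vu : v.1 != u.1 by rewrite eq_sym.
rewrite /refl2 !negK conjgC tpermJ; congr (_ * tperm _ _); apply: tpermD;
  by rewrite ?(eq_sym _ (neg _)) ?neg_neq ?point_neq // eq_sym neg_neq.
Qed.

Lemma refl2_neg u v z : u.1 != v.1 -> refl2 u v (neg z) = neg (refl2 u v z).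
Proof.
move=> uv; rewrite -{1}(refl2N uv) /refl2 !permM !negK tperm_neg.
by rewrite -[RHS]tperm_neg !negK.
Qed.

Lemma refl2L u v : u.1 != v.1 -> refl2 u v u = v.
Proof.
move=> uv; rewrite /refl2 permM tpermL tpermD ?neg_neq //.
exact: point_neq.
Qed.

Lemma refl2R u v : u.1 != v.1 -> refl2 u v v = u.
Proof. by move=> uv; rewrite refl2C refl2L // eq_sym. Qed.

Lemma refl2D u v z : u.1 != z.1 -> v.1 != z.1 -> refl2 u v z = z.
Proof. by move=> uz vz; rewrite /refl2 permM !tpermD //; exact: point_neq. Qed.

Lemma refl2J u v a b : a.1 != b.1 ->
  refl2 u v ^ refl2 a b = refl2 (refl2 a b u) (refl2 a b v).
Proof. by move=> ab; rewrite /refl2 conjMg !tpermJ -/(refl2 a b) !refl2_neg. Qed.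

Lemma refl2_sq u v : u.1 != v.1 -> refl2 u v * refl2 u v = 1.
Proof.
move=> uv; rewrite -{2}(refl2N uv) /refl2 !negK -mulgA (mulgA (tperm (neg u) _)).
by rewrite tperm2 mul1g tperm2.
Qed.

Lemma refl2_braid u v w : u.1 != v.1 -> v.1 != w.1 -> u.1 != w.1 ->
  braid3 (refl2 u v) (refl2 v w).
Proof.
move=> uv vw uw; have wu : w.1 != u.1 by rewrite eq_sym.
have vu : v.1 != u.1 by rewrite eq_sym.
have wv : w.1 != v.1 by rewrite eq_sym.
apply: braid3_invol; [exact: refl2_sq | exact: refl2_sq |].
by rewrite !refl2J // refl2L // refl2R // !refl2D // refl2L.
Qed.

Lemma refl2_disjoint u v a b : u.1 != a.1 -> u.1 != b.1 -> v.1 != a.1 ->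
  v.1 != b.1 -> a.1 != b.1 -> commute (refl2 u v) (refl2 a b).
Proof.
move=> ua ub va vb ab; apply: conjg_fix_commute.
by rewrite refl2J // !refl2D // eq_sym.
Qed.

(** The reflection in [e_j + e_i] sends [e_j] to [-e_i], whence the negated sign of the second
    point. *)
Definition label_perm (x : label) : {perm signed_point} :=
  refl2 (pt x.1.2 true) (pt x.1.1 (~~ x.2)).

Lemma pt_neq i j s t : i <= M -> j <= M -> i != j -> (pt i s).1 != (pt j t).1.
Proof.
move=> iM jM; apply: contraNneq => /(congr1 val) /=.
by rewrite !inordK // => ->.
Qed.

(** The image of [pt j true] decides: it is [pt i (~~ s)] with [i < j]. If [j = l], this yields [i]
    and [s]; if [j = k], its index would be [l > j]; in all other cases [pt j true] would be
    fixed. *)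
Lemma label_perm_inj x y : label_wf M x -> label_wf M y ->
  label_perm x = label_perm y -> x = y.
Proof.
case: x y => [[i j] s] [[k l] t]; rewrite /label_wf /label_perm /= => ij kl e.
have [/andP[lij jM] /andP[lkl lM]] := (ij, kl).
have iM : i <= M by lia. have kM : k <= M by lia.
have xj : refl2 (pt j true) (pt i (~~ s)) (pt j true) = pt i (~~ s).
  by apply: refl2L; apply: pt_neq; lia.
have nkl a b : (pt l a).1 != (pt k b).1 by apply: pt_neq; lia.
have [jl|jl] := eqVneq j l.
  move: xj; rewrite e -jl refl2L; last by rewrite jl.
  move=> [/(congr1 val)]; rewrite /= !inordK // => -> /eqP.
  by rewrite eqb_negLR negbK => /eqP ->.
have [jk|jk] := eqVneq j k.
  have {}nkl a b : (pt l a).1 != (pt j b).1 by rewrite jk.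
  move: xj; rewrite e -jk -[pt j true]negK -/(pt j false).
  case: t {e}; last first.
    by rewrite negK refl2R // => -[/(congr1 val)]; rewrite /= !inordK //; lia.
  by rewrite refl2_neg // refl2R // => -[/(congr1 val)]; rewrite /= !inordK //; lia.
move: xj; rewrite e refl2D; try by apply: pt_neq; lia.
by move=> [/(congr1 val)]; rewrite /= !inordK //; lia.
Qed.

Lemma label_perm_bandJ i j k s : i < j -> j < k -> k <= M ->
  label_perm (i, j, s) ^ label_perm (j, k, false) = label_perm (i, k, s).
Proof.
move=> ij jk kM; rewrite /label_perm /= refl2J; last by apply: pt_neq; lia.
rewrite refl2R; last by apply: pt_neq; lia.
by rewrite refl2D //; apply: pt_neq; lia.
Qed.

Lemma label_perm_arcJ i j : 0 < i -> i < j -> j <= M ->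
  label_perm (0, i, false) ^ label_perm (0, j, true) = label_perm (i, j, true).
Proof.
move=> i0 ij jM; rewrite /label_perm /= refl2J; last by apply: pt_neq; lia.
rewrite refl2D; try by apply: pt_neq; lia.
rewrite -[pt 0 true]/(neg (pt 0 false)) refl2_neg; last by apply: pt_neq; lia.
rewrite refl2R; last by apply: pt_neq; lia.
rewrite refl2C -refl2N; last by apply: pt_neq; lia.
by rewrite negK.
Qed.

Lemma label_perm_sq x : label_wf M x -> label_perm x * label_perm x = 1.
Proof. by move=> /andP[ij jM]; apply: refl2_sq; apply: pt_neq; lia. Qed.

Lemma label_permV x : label_wf M x -> (label_perm x)^-1 = label_perm x.
Proof. by move=> x_wf; apply/mulg1_eq/label_perm_sq. Qed.

Definition simple_label (k : nat) : label :=
  if k is k'.+1 then (k', k, false) else (0, 1%N, true).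

Definition simple_perm (k : nat) : {perm signed_point} := label_perm (simple_label k).

Lemma simple_label_wf k : 0 < M -> k <= M -> label_wf M (simple_label k).
Proof. by case: k => //= k _ kM; rewrite /label_wf /= ltnSn. Qed.

Lemma simple_perm_comm a b : a < b -> b <= M ->
  ~~ ((a == 0) && (b == 2)) -> ~~ ((0 < a) && (b == a.+1)) ->
  commute (simple_perm a) (simple_perm b).
Proof.
case: a b => [|a] [|[|b]] //= ab bM ne1 ne2.
  apply: conjg_fix_commute; rewrite /simple_perm /label_perm /= refl2J;
    last by apply: pt_neq; lia.
  rewrite refl2L; last by apply: pt_neq; lia.
  rewrite -[pt 0 false]/(neg (pt 0 true)) refl2_neg; last by apply: pt_neq; lia.
  rewrite refl2R; last by apply: pt_neq; lia.
  rewrite refl2C -refl2N; last by apply: pt_neq; lia.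
  by rewrite negK.
all: by apply: refl2_disjoint; apply: pt_neq => /=; lia.
Qed.

Lemma simple_perm_braid a b : a < b -> b <= M ->
  (a == 0) && (b == 2) || (0 < a) && (b == a.+1) ->
  braid3 (simple_perm a) (simple_perm b).
Proof.
move=> ab bM adj; rewrite /simple_perm /label_perm.
have [e|e] := orP adj; case/andP: e => e1 /eqP e2; rewrite e2 in bM *.
  rewrite (eqP e1) /= refl2C (refl2C (pt 2 true)).
  by apply: refl2_braid; apply: pt_neq; lia.
case: a e1 {ab adj e2} bM => // a _ aM; rewrite /= refl2C (refl2C (pt a.+2 true)).
by apply: refl2_braid; apply: pt_neq; lia.
Qed.

Lemma label_lift_perm x : label_wf M x ->
  label_lift (simple_perm 0) (fun i => simple_perm i.+1) x = label_perm x.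
Proof.
have band_perm i j : i < j -> j <= M ->
    band (fun i => simple_perm i.+1) i j = label_perm (i, j, false).
  move: j; apply: band_ind => [|j ij IHj] jM; first by rewrite band1.
  rewrite bandS // IHj; last exact: ltnW.
  by rewrite /simple_perm /= label_permV ?label_perm_bandJ /label_wf //=; lia.
have spoke_perm s j : 0 < j -> j <= M ->
    spoke (simple_perm 0) (fun i => simple_perm i.+1) s j = label_perm (0, j, s).
  rewrite /spoke; move: j; apply: band_ind => [|j ij IHj] jM.
    by rewrite band1 /chain; case: s.
  rewrite bandS // IHj; last exact: ltnW.
  rewrite /chain (gtn_eqF ij) andbF.
  by rewrite /simple_perm /= label_permV ?label_perm_bandJ /label_wf //=; lia.
case: x => [[i j] s] /andP[/= ij jM]; rewrite /label_lift.
have [-> |i0] := posnP i; first by rewrite spoke_perm //; lia.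
case: s; last exact: band_perm.
rewrite /fork_arc !spoke_perm; [|lia..].
by rewrite label_permV ?label_perm_arcJ /label_wf //=; lia.
Qed.

End SignedPermutations.

(** * Uniqueness of the dual lifts *)

Section Morphisms.
Variables (G H : groupType) (phi : G -> H).
Hypothesis phiM : {morph phi : x y / x * y}.

Lemma morph_one : phi 1 = 1.
Proof. by apply: (mulgI (phi 1)); rewrite -phiM !mulg1. Qed.

Lemma morph_inv x : phi x^-1 = (phi x)^-1.
Proof. by apply/esym/mulg1_eq; rewrite -phiM mulgV morph_one. Qed.

Lemma morph_conj x y : phi (x ^ y) = phi x ^ phi y.
Proof. by rewrite !conjgE !phiM morph_inv. Qed.

Lemma morph_exp x k : phi (x ^+ k) = phi x ^+ k.
Proof. by elim: k => [|k IHk]; rewrite ?morph_one // !expgS phiM IHk. Qed.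

Lemma morph_prod (I : Type) (r : seq I) (F : I -> G) :
  phi (\prod_(i <- r) F i) = \prod_(i <- r) phi (F i).
Proof. exact: (big_morph phi phiM morph_one). Qed.

Lemma band_morph (f : nat -> G) (f' : nat -> H) i j :
  (forall k, k < j -> phi (f k) = f' k) -> i < j ->
  phi (band f i j) = band f' i j.
Proof.
move=> + ij; move: j ij; apply: band_ind => [|j ij IHj] ff'.
  by rewrite !band1 ff'.
rewrite !bandS // morph_conj morph_inv ff' // IHj // => k kj.
by apply: ff'; rewrite ltnS ltnW.
Qed.

Lemma label_lift_morph M (g0 : G) (f : nat -> G) (g0' : H) (f' : nat -> H) x :
  phi g0 = g0' -> (forall k, k < M -> phi (f k) = f' k) -> label_wf M x ->
  phi (label_lift g0 f x) = label_lift g0' f' x.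
Proof.
move=> g00' ff'; case: x => [[i j] s] /andP[/= ij jM].
have spoke_morph t k : 0 < k -> k <= M -> phi (spoke g0 f t k) = spoke g0' f' t k.
  move=> k0 kM; apply: band_morph => // l lk; rewrite /chain.
  by case: ifP => // _; apply: ff'; exact: leq_trans kM.
rewrite /label_lift; case: posnP => [i0|i0]; first by apply: spoke_morph; lia.
case: s; first by rewrite /fork_arc morph_conj morph_inv !spoke_morph //; lia.
by apply: band_morph => // k kj; apply: ff'; exact: leq_trans jM.
Qed.

End Morphisms.

Section ExtendGenerators.
Variables (n : nat) (G : groupType) (f : 'I_n -> G).

(** The default [1] commutes with everything, so the commutation hypotheses on bands and forks,
    which are stated for all indices, hold out of range as well. *)
Definition extend (k : nat) : G := if insub k is Some j then f j else 1.

Lemma extend_ord (j : 'I_n) : extend j = f j.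
Proof. by rewrite /extend valK. Qed.

Lemma extend_out k : n <= k -> extend k = 1.
Proof. by move=> nk; rewrite /extend insubN // -leqNgt. Qed.

Hypothesis fD : respects_rel (braid_rel (@Dmat n)) f.

Let extend_rel a b (an : a < n) (bn : b < n) (ia := Ordinal an) (ib := Ordinal bn) :
  \prod_(x <- alt (Dmat ia ib) ia ib) f x =
  \prod_(x <- alt (Dmat ia ib) ib ia) f x.
Proof. by rewrite -!weval_pos; apply: fD; exists ia, ib. Qed.

Lemma extend_comm a b : a < b -> ~~ ((a == 0) && (b == 2)) ->
  ~~ ((0 < a) && (b == a.+1)) -> commute (extend a) (extend b).
Proof.
move=> ab h1 h2; have [nb|bn] := leqP n b.
  by rewrite (extend_out nb); exact: commute1.
have an := ltn_trans ab bn; have := extend_rel an bn.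
rewrite /Dmat /= (minn_idPl (ltnW ab)) (maxn_idPr (ltnW ab)) (ltn_eqF ab).
rewrite (negbTE h1) (negbTE h2) /= !big_cons !big_nil !mulg1.
by rewrite -(extend_ord (Ordinal an)) -(extend_ord (Ordinal bn)).
Qed.

Lemma extend_braid a b : a < b -> b < n ->
  (a == 0) && (b == 2) || (0 < a) && (b == a.+1) ->
  braid3 (extend a) (extend b).
Proof.
move=> ab bn h; have an := ltn_trans ab bn; have := extend_rel an bn.
rewrite /Dmat /= (minn_idPl (ltnW ab)) (maxn_idPr (ltnW ab)) (ltn_eqF ab).
rewrite h /= !big_cons !big_nil !mulg1.
by rewrite -(extend_ord (Ordinal an)) -(extend_ord (Ordinal bn)) !mulgA.
Qed.

Definition type_D_lift : label -> G := label_lift (extend 0) (fun i => extend i.+1).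

Ltac fork_relation := first [apply: extend_comm; lia | apply: extend_braid; lia].

Lemma type_D_lift_exceptional L tup : exceptional n.-1 L ->
  hurwitz_equiv [seq type_D_lift x | x <- L] tup ->
  exists2 L', exceptional n.-1 L' & tup = [seq type_D_lift x | x <- L'].
Proof.
by apply: hurwitz_exceptional => *; fork_relation.
Qed.

Lemma type_D_lift_triangle x y z : label_triangle x y z ->
  label_wf n.-1 x -> label_wf n.-1 y -> label_wf n.-1 z ->
  dual_triangle (type_D_lift x) (type_D_lift y) (type_D_lift z).
Proof.
by move=> t wx wy wz; apply: label_lift_triangle t wx wy wz => *; fork_relation.
Qed.

Lemma type_D_lift_comm x y : label_wf n.-1 x -> label_wf n.-1 y ->
  label_comm x y -> commute (type_D_lift x) (type_D_lift y).
Proof.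
by move=> wx wy c; apply: label_lift_comm wx wy c => *; fork_relation.
Qed.

Lemma type_D_lift_simple k : type_D_lift (simple_label k) = extend k.
Proof.
case: k => [|k] /=; first by rewrite /type_D_lift /= /spoke band1.
rewrite /type_D_lift /label_lift; case: eqP => [->|_]; last by rewrite band1.
by rewrite /spoke band1.
Qed.

End ExtendGenerators.

Lemma exceptional_simple n : 2 < n ->
  exceptional n.-1 [seq simple_label k | k <- rev (iota 0 n)].
Proof.
move=> n3; apply/andP; split.
  apply/allP => x /mapP[k]; rewrite mem_rev mem_iota => kn ->.
  by apply: simple_label_wf; lia.
rewrite pairwise_map; apply: (@sub_pairwise _ gtn).
  move=> i j /= ji; apply/eqP; case: i j ji => [|i] [|j] //= ji;
    rewrite /euler /eulerr /sign_int /=.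
    by have [->|i0] := posnP i; euler_simp.
  by have [->|j0] := posnP j; euler_simp.
rewrite -sorted_pairwise; last by move=> i j k /= ji ik; exact: ltn_trans ik ji.
by rewrite rev_sorted; exact: iota_ltn_sorted.
Qed.

Section TypeDLifts.
Variable n : nat.
Hypothesis n3 : 2 < n.

Let M := n.-1.

Definition dual_lift_at : label -> braid_group (@Dmat n) :=
  type_D_lift (artin_gen (@Dmat n)).

Definition refl_at : label -> coxeter_group (@Dmat n) := type_D_lift (@simpleD n).

Lemma projD_gen i : Defs.proj (@simpleD n) (artin_gen (@Dmat n) i) = simpleD i.
Proof. exact/pres_map_gen/respects_simpleD. Qed.

Lemma proj_dual_lift_at x : label_wf M x ->
  Defs.proj (@simpleD n) (dual_lift_at x) = refl_at x.
Proof.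
have projE k : Defs.proj (@simpleD n) (extend (artin_gen (@Dmat n)) k) =
    extend (@simpleD n) k.
  rewrite /extend; case: insubP => [j _ _|_]; first exact: projD_gen.
  exact: (morph_one (@projDM n)).
by apply: label_lift_morph => //; exact: projDM.
Qed.

Definition signed_perm : coxeter_group (@Dmat n) -> {perm signed_point M} :=
  pres_map (fun j : 'I_n => simple_perm M j).

Lemma respects_simple_perm :
  respects_rel (cox_rel (@Dmat n)) (fun j : 'I_n => simple_perm M j).
Proof.
have sq (j : 'I_n) : simple_perm M j * simple_perm M j = 1.
  by apply/label_perm_sq/simple_label_wf; have := ltn_ord j; rewrite /M; lia.
move=> _ _ [i [j [-> ->]]].
have -> : weval (fun j : 'I_n => simple_perm M j) [::] = 1 by rewrite /weval big_nil.
have key k (x y : {perm signed_point M}) (I : Type)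
    (F : I -> {perm signed_point M}) a b : F a = x -> F b = y ->
    weval F (flatten (nseq k (pos_word [:: a; b]))) = (x * y) ^+ k.
  move=> <- <-; elim: k => [|k IHk]; first by rewrite /weval big_nil.
  by rewrite /= /weval !big_cons -/(weval _ _) IHk /= mulgA expgS.
rewrite (key _ (simple_perm M i) (simple_perm M j)) //.
have sym (x y : {perm signed_point M}) k : (x * y) ^+ k = 1 -> (y * x) ^+ k = 1.
  move=> xy; have -> : y * x = (x * y) ^ x by rewrite conjgE -mulgA mulKg.
  by rewrite -conjXg xy conj1g.
have half (a b : 'I_n) : a < b ->
    (simple_perm M a * simple_perm M b) ^+ Dmat a b = 1.
  move=> ab; have bM : b <= M by have := ltn_ord b; rewrite /M; lia.
  rewrite /Dmat (minn_idPl (ltnW ab)) (maxn_idPr (ltnW ab)) (ltn_eqF ab).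
  case: ifP => [adj|/negbT nadj].
    by apply: braid3_order3; rewrite ?sq //; exact: simple_perm_braid.
  rewrite expgMn; last by apply: simple_perm_comm; lia.
  by rewrite !expg2 !sq mulg1.
case: (ltngtP i j) => [ij|ji|/val_inj ->]; first exact: half.
  by apply: sym; rewrite [Dmat _ _](_ : _ = Dmat j i) ?half // /Dmat minnC maxnC.
by rewrite Dmat1 expg1 sq.
Qed.

Lemma signed_perm_M : {morph signed_perm : x y / x * y}.
Proof. exact/pres_mapM/respects_simple_perm. Qed.

Lemma signed_perm_refl_at x : label_wf M x -> signed_perm (refl_at x) = label_perm M x.
Proof.
move=> x_wf; rewrite -label_lift_perm //.
have extendE k : k <= M -> signed_perm (extend (@simpleD n) k) = simple_perm M k.
  move=> kM; have kn : k < n by rewrite /M in kM; lia.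
  rewrite -[k in LHS]/(val (Ordinal kn)) extend_ord.
  exact: (pres_map_gen respects_simple_perm).
apply: label_lift_morph x_wf; first exact: signed_perm_M.
  exact: extendE.
by move=> k kM; exact: extendE.
Qed.

Lemma refl_at_inj x y : label_wf M x -> label_wf M y -> refl_at x = refl_at y -> x = y.
Proof.
move=> wx wy xy; apply: (label_perm_inj wx wy).
by rewrite -!signed_perm_refl_at // xy.
Qed.

Lemma artin_tuple : [seq artin_gen (@Dmat n) i | i <- cD n] =
  [seq dual_lift_at x | x <- [seq simple_label k | k <- rev (iota 0 n)]].
Proof.
rewrite /cD -val_enum_ord -map_rev -!map_comp; apply: eq_map => i /=.
by rewrite /dual_lift_at type_D_lift_simple extend_ord.
Qed.

Lemma hurwitz_entry tup b :
  hurwitz_equiv [seq artin_gen (@Dmat n) i | i <- cD n] tup -> b \in tup ->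
  exists2 x, label_wf M x & b = dual_lift_at x.
Proof.
rewrite artin_tuple => h.
have [|L' /andP[/allP L_wf _] -> /mapP[x xL ->]] :=
  type_D_lift_exceptional _ (exceptional_simple n3) h.
  exact: respects_gen.
by exists x => //; exact: L_wf.
Qed.

(** Both [b] and the lift picked by [xget] are [dual_lift_at] of some label. Their projections
    agree, and [refl_at_inj] makes the two labels equal. *)
Lemma dual_lift_entry tup b :
  hurwitz_equiv [seq artin_gen (@Dmat n) i | i <- cD n] tup -> b \in tup ->
  dual_lift (@Dmat n) (@simpleD n) (cD n) (Defs.proj (@simpleD n) b) = b.
Proof.
move=> h bt; rewrite /dual_lift.
set P := (X in xget _ X); have Pb : P b by split=> //; exists tup.
have [e [t' h' bt']] := xgetPex 1 (ex_intro _ b Pb).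
have [x wx ex] := hurwitz_entry h bt.
have [y wy ey] := hurwitz_entry h' bt'.
rewrite [RHS]ex ey; congr dual_lift_at; apply: refl_at_inj => //.
by rewrite -!proj_dual_lift_at // -ey e ex.
Qed.

End TypeDLifts.

(** * Hurwitz equivalence *)

Section HurwitzEquivalence.
Variable G : groupType.
Implicit Types (x y : G) (u v w : seq G).

Lemma hurwitz_trans u v w :
  hurwitz_equiv u v -> hurwitz_equiv v w -> hurwitz_equiv u w.
Proof.
move=> uv vw; elim: vw uv => {v w} [//|v w z _ IH wz uv|v w z _ IH zw uv].
  exact: hurwitz_step (IH uv) wz.
exact: hurwitz_inv (IH uv) zw.
Qed.

Lemma hurwitz_sym u v : hurwitz_equiv u v -> hurwitz_equiv v u.
Proof.
elim=> {u v} [u|u v w _ vu vw|u v w _ vu wv]; first exact: hurwitz_refl.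
  by apply: hurwitz_trans vu; exact: hurwitz_inv (hurwitz_refl _) vw.
by apply: hurwitz_trans vu; exact: hurwitz_step (hurwitz_refl _) wv.
Qed.

Lemma hurwitz_cat a b u v :
  hurwitz_equiv u v -> hurwitz_equiv (a ++ u ++ b) (a ++ v ++ b).
Proof.
have move_cat u' v' : hurwitz_move u' v' -> hurwitz_move (a ++ u' ++ b) (a ++ v' ++ b).
  by case=> p x y q; rewrite -!catA !(catA a) !cat_cons; exact: HurwitzMove.
elim=> {u v} [u|u v w _ IH /move_cat|u v w _ IH /move_cat].
- exact: hurwitz_refl.
- exact: hurwitz_step.
- exact: hurwitz_inv.
Qed.

Lemma hurwitz_pass u y :
  hurwitz_equiv (rcons u y) (y ^ (\prod_(x <- u) x)^-1 :: u).
Proof.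
elim/last_ind: u y => [|u x IHu] y.
  by rewrite big_nil invg1 conjg1; exact: hurwitz_refl.
rewrite -cats1 -[rcons u x]cats1 -catA /=.
apply: (@hurwitz_trans _ (u ++ [:: x * y * x^-1; x])).
  by apply: (hurwitz_step (hurwitz_refl _)); exact: HurwitzMove.
have := hurwitz_cat [::] [:: x] (IHu (x * y * x^-1)).
rewrite cat0s cat_rcons /= big_cat big_seq1 invgM conjgM.
by rewrite [y ^ x^-1]conjgE invgK mulgA.
Qed.

Lemma hurwitz_pass_seq u v :
  hurwitz_equiv (u ++ v) ([seq y ^ (\prod_(x <- u) x)^-1 | y <- v] ++ u).
Proof.
elim: v => [|y v IHv]; first by rewrite cats0; exact: hurwitz_refl.
rewrite -cat_rcons /=; apply: (@hurwitz_trans _ (y ^ (\prod_(x <- u) x)^-1 :: u ++ v)).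
  exact: (hurwitz_cat [::] v (hurwitz_pass u y)).
by have := hurwitz_cat [:: y ^ (\prod_(x <- u) x)^-1] [::] IHv; rewrite /= !cats0.
Qed.

Lemma hurwitz_prod u v : hurwitz_equiv u v -> \prod_(x <- u) x = \prod_(x <- v) x.
Proof.
have move_prod u' v' : hurwitz_move u' v' -> \prod_(x <- u') x = \prod_(x <- v') x.
  by case=> p x y q; rewrite !big_cat !big_cons /= !mulgA mulgVK.
by elim=> {u v} [//|u v w _ -> /move_prod|u v w _ -> /move_prod].
Qed.

Lemma hurwitz_rotate u v c : c = \prod_(x <- u ++ v) x ->
  hurwitz_equiv (u ++ v) ([seq y ^ c^-1 | y <- v] ++ u).
Proof.
elim/last_ind: v u => [|v y IHv] u cE; first by rewrite cats0; exact: hurwitz_refl.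
(* As [y] commutes with itself, conjugation by the product of the preceding letters acts on it like
   conjugation by [c]. The tuple after the pass still has product [c], so the induction applies to
   it. *)
have yc : y ^ (\prod_(x <- u ++ v) x)^-1 = y ^ c^-1.
  rewrite cE -rcons_cat big_rcons invgM conjgM /=.
  by rewrite (conjg_commute (commuteV (commute_refl y))).
have pass := hurwitz_pass (u ++ v) y; rewrite yc rcons_cat in pass.
rewrite map_rcons cat_rcons; apply: hurwitz_trans (pass) _.
by apply: (IHv (_ :: u)); exact: etrans cE (hurwitz_prod pass).
Qed.

Lemma hurwitz_conj_prod u (c := \prod_(x <- u) x) k :
  hurwitz_equiv u [seq y ^ (c ^+ k)^-1 | y <- u].
Proof.
elim: k => [|k IHk].
  by rewrite expg0 invg1 (eq_map (@conjg1 _)) map_id; exact: hurwitz_refl.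
apply: hurwitz_trans IHk _.
have e : [seq y ^ (c ^+ k.+1)^-1 | y <- u] =
    [seq z ^ c^-1 | z <- [seq y ^ (c ^+ k)^-1 | y <- u]].
  by rewrite -map_comp; apply: eq_map => y /=; rewrite -conjgM -invgM -expgS.
have := @hurwitz_rotate [::] [seq y ^ (c ^+ k)^-1 | y <- u] c.
rewrite e cats0 big_map -conjg_prod -/c; apply.
by rewrite (conjg_commute (commuteV (commuteX _ (commute_refl c)))).
Qed.

(** By [k] full turns the tuple gets conjugated by [c ^ k], and one more pass takes [y] across [u1].
    The grid reflections have exactly this shape. *)
Lemma hurwitz_prefix_entry u1 y u2 k (u := u1 ++ y :: u2) (c := \prod_(x <- u) x) :
  exists2 tup, hurwitz_equiv u tup & y ^ (c ^+ k * \prod_(x <- u1) x)^-1 \in tup.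
Proof.
exists [seq z ^ (c ^+ k)^-1 | z <- (y ^ (\prod_(x <- u1) x)^-1 :: u1) ++ u2].
  apply: hurwitz_trans (hurwitz_conj_prod u k) _.
  rewrite -/c; generalize (c ^+ k)^-1 => d; rewrite /u -cat_rcons !map_cat.
  have := hurwitz_pass [seq z ^ d | z <- u1] (y ^ d).
  rewrite big_map -conjg_prod -conjVg -conjJg -map_rcons => /(hurwitz_cat [::]).
  exact.
by rewrite /= inE invgM conjgM eqxx.
Qed.

End HurwitzEquivalence.

(** * Folding *)

Section Folding.
Variable n : nat.
Hypothesis n3 : 2 < n.

Let M := n.-1.
Let braidB : groupType := braid_group (@Bmat n.-1).
Let braidD : groupType := braid_group (@Dmat n).
Let W : groupType := coxeter_group (@Dmat n).

(** Index 1 precedes index 0 as in the word of [c], so that concatenating the fibers along [cF]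
    spells [cD] letter by letter. *)
Definition fiber (i : nat) : seq nat := if i == 0 then [:: 1%N; 0] else [:: i.+1].

Lemma fiber_lt i k : i < n.-1 -> k \in fiber i -> k < n.
Proof.
rewrite /fiber => iM; case: eqP => _; rewrite !inE; last by move/eqP->; lia.
by case/orP=> /eqP ->; lia.
Qed.

Lemma fiber_theta (i : 'I_n.-1) (k : 'I_n) :
  (k \in theta_orbit i) = (val k \in fiber i).
Proof.
rewrite inE /fiber /theta; case: (posnP i) => [->|i0]; first by rewrite !inE.
by rewrite eqSS (gtn_eqF i0) inE orbb.
Qed.

Lemma fold_fiber (G : groupType) (f : 'I_n -> G) (i : 'I_n.-1) :
  respects_rel (braid_rel (@Dmat n)) f ->
  fold f i = \prod_(k <- fiber i) extend f k.
Proof.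
move=> fD; rewrite /fiber; case: posnP => i0; last first.
  by rewrite big_seq1 (foldS f i0).
rewrite (fold0 fD i0) !big_cons big_nil /= mulg1.
exact: (@extend_comm _ _ _ fD 0 1%N).
Qed.

Lemma fiber_commute (G : groupType) (f : 'I_n -> G) i k l :
  respects_rel (braid_rel (@Dmat n)) f ->
  k \in fiber i -> l \in fiber i -> commute (extend f k) (extend f l).
Proof.
move=> fD; have c : commute (extend f 0) (extend f 1) by exact: (extend_comm fD).
rewrite /fiber; case: eqP => _; rewrite !inE; last by move=> /eqP -> /eqP ->.
by move=> /orP[] /eqP -> /orP[] /eqP -> //; exact: commute_sym.
Qed.

Definition artinD (k : nat) : braidD := extend (artin_gen (@Dmat n)) k.
Definition simpleN (k : nat) : W := extend (@simpleD n) k.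
Definition projB : braidB -> W := Defs.proj (@simpleF n).
Definition projD : braidD -> W := Defs.proj (@simpleD n).

Lemma projB_M : {morph projB : x y / x * y}. Proof. exact: projFM. Qed.

Lemma projD_M : {morph projD : x y / x * y}. Proof. exact: projDM. Qed.

Lemma projDE k : projD (artinD k) = simpleN k.
Proof.
rewrite /artinD /simpleN /extend; case: insubP => [j _ _|_]; first exact: projD_gen.
exact: (morph_one projD_M).
Qed.

Lemma projB_gen i : projB (artin_gen (@Bmat n.-1) i) = simpleF i.
Proof. exact/pres_map_gen/respects_simpleF. Qed.

Lemma iota_fold_fiber i :
  iota_fold (artin_gen (@Bmat n.-1) i) = \prod_(k <- fiber i) artinD k.
Proof.
rewrite iota_fold_gen -[LHS]/(fold (artin_gen (@Dmat n)) i) fold_fiber //.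
exact: respects_gen.
Qed.

Lemma simpleF_fiber i : simpleF i = \prod_(k <- fiber i) simpleN k.
Proof. by rewrite /simpleF fold_fiber //; exact: respects_simpleD. Qed.

Lemma proj_iota_fold b : projD (iota_fold b) = projB b.
Proof.
rewrite -[b]reprK -weval_gen /weval.
rewrite (morph_prod (@iota_foldM n)) (morph_prod projD_M) (morph_prod projB_M).
apply: eq_bigr => -[i s] _ /=.
have e : projD (iota_fold (artin_gen (@Bmat n.-1) i)) =
    projB (artin_gen (@Bmat n.-1) i).
  rewrite projB_gen iota_fold_fiber (morph_prod projD_M) simpleF_fiber.
  by apply: eq_bigr => k _; exact: projDE.
case: s => //.
by rewrite (morph_inv (@iota_foldM n)) (morph_inv projD_M) (morph_inv projB_M) e.
Qed.

(** A type B entry is stored as a pair [(b, i)] standing for [b s_i b^-1]: its splitting into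
    commuting type D factors is read off this expression, not off the element. *)
Definition block (x : braidB * 'I_n.-1) : seq braidD :=
  [seq artinD k ^ (iota_fold x.1)^-1 | k <- fiber x.2].

Definition entryB (x : braidB * 'I_n.-1) : braidB :=
  artin_gen (@Bmat n.-1) x.2 ^ x.1^-1.

Lemma block_prod x : \prod_(y <- block x) y = iota_fold (entryB x).
Proof.
rewrite /entryB (morph_conj (@iota_foldM n)) (morph_inv (@iota_foldM n)).
by rewrite iota_fold_fiber conjg_prod big_map.
Qed.

Lemma block_conj b x :
  [seq y ^ (iota_fold b)^-1 | y <- block x] = block (b * x.1, x.2).
Proof.
rewrite /block -map_comp; apply: eq_map => k /=.
by rewrite iota_foldM invgM conjgM.
Qed.

Lemma entryB_conj b x : entryB (b * x.1, x.2) = b * entryB x * b^-1.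
Proof. by rewrite /entryB /= invgM conjgM [LHS]conjgE invgK mulgA. Qed.

Lemma block_move x y :
  hurwitz_equiv (block x ++ block y) (block (entryB x * y.1, y.2) ++ block x).
Proof.
have := hurwitz_pass_seq (block x) (block y).
by rewrite block_prod block_conj.
Qed.

Lemma cF_fiber : flatten [seq fiber i | i : 'I_n.-1 <- cF n] = rev (iota 0 n).
Proof.
have -> : [seq fiber i | i : 'I_n.-1 <- cF n] = [seq fiber i | i <- rev (iota 0 n.-1)].
  by rewrite /cF -val_enum_ord -map_rev -map_comp.
case: n n3 => [|[|m]] // _.
rewrite [iota 0 m.+2.-1]/= -cat1s rev_cat map_cat flatten_cat.
rewrite -[iota 0 m.+2]/([:: 0; 1%N] ++ iota 2 m) rev_cat; congr (_ ++ _).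
rewrite -[2%N]/(1 + 1)%N iotaDl -map_rev.
have : all (fun i => 0 < i) (rev (iota 1 m)).
  by rewrite all_rev; apply/allP => i; rewrite mem_iota => /andP[].
elim: (rev _) => //= i r IHr /andP[i0 /IHr ->].
by rewrite /fiber (gtn_eqF i0).
Qed.

Lemma hurwitz_fold tup :
  hurwitz_equiv [seq artin_gen (@Bmat n.-1) i | i <- cF n] tup ->
  exists L, tup = [seq entryB x | x <- L] /\
    hurwitz_equiv [seq artin_gen (@Dmat n) i | i <- cD n]
      (flatten [seq block x | x <- L]).
Proof.
have flat L1 x y L2 : flatten [seq block z | z <- L1 ++ [:: x, y & L2]] =
    flatten [seq block z | z <- L1] ++ (block x ++ block y) ++
    flatten [seq block z | z <- L2].
  by rewrite map_cat flatten_cat /= !catA.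
move et0: [seq artin_gen (@Bmat n.-1) i | i <- cF n] => t0 h.
elim: h et0 => {t0 tup} [t <-|t u v _ IH uv e|t u v _ IH vu e].
- exists [seq (1, i) | i <- cF n]; split.
    by rewrite -map_comp; apply: eq_map => i; rewrite /entryB /= invg1 conjg1.
  have -> : flatten [seq block x | x <- [seq (1, i) | i <- cF n]] =
      [seq artin_gen (@Dmat n) i | i <- cD n]; last exact: hurwitz_refl.
  rewrite -map_comp (eq_map (g := map artinD \o (fun i : 'I_n.-1 => fiber i))); last first.
    move=> i; rewrite /block /= (morph_one (@iota_foldM n)) invg1.
    by apply: eq_map => k; rewrite conjg1.
  rewrite map_comp -map_flatten cF_fiber /cD -val_enum_ord -map_rev -map_comp.
  by apply: eq_map => i /=; exact: extend_ord.
- case: uv (IH e) => {t u v IH e} u g h v [L [e]].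
  have [L1 [x [y [L2 [-> -> -> -> ->]]]]] := map_eq_cat2 (esym e) => ht.
  exists (L1 ++ [:: (entryB x * y.1, y.2), x & L2]); split.
    by rewrite map_cat /= entryB_conj.
  apply: hurwitz_trans ht _; rewrite !flat; apply: hurwitz_cat; exact: block_move.
have {IH} := IH e; case: vu => {t u v e} u g h v [L [e]].
have [L1 [z [x [L2 [-> -> gh gx ->]]]]] := map_eq_cat2 (esym e) => ht.
rewrite gx in gh *.
(* Chosen so that the forward move turns the pair [x], [y] into [z], [x]. *)
set y := ((entryB x)^-1 * z.1, z.2).
have zE : z = (entryB x * y.1, y.2) by rewrite /= mulVKg; case: (z).
have conjK (a b : braidB) : a^-1 * (a * b * a^-1) * a^-1^-1 = b.
  by rewrite invgK !mulgA mulVg mul1g mulgVK.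
have hE : entryB y = h by rewrite entryB_conj -gh conjK.
exists (L1 ++ [:: x, y & L2]); split; first by rewrite map_cat /= hE.
apply: hurwitz_trans ht _; rewrite !flat; apply: hurwitz_cat.
by rewrite {1}zE; apply: hurwitz_sym; exact: block_move.
Qed.
End Folding.

(** * Orbits of theta on reflections, and their independence of the expression *)

Section FoldedReflections.
Variable n : nat.
Hypothesis n3 : 2 < n.

Let M := n.-1.
Let W : groupType := coxeter_group (@Dmat n).

Definition spoke_refl (k : nat) (e : bool) : W := refl_at n (0, k, e).

Lemma simpleN_sq k : k < n -> simpleN n k * simpleN n k = 1.
Proof.
move=> kn; rewrite /simpleN -[k]/(val (Ordinal kn)) extend_ord.
exact/coxeter_sq/Dmat1.
Qed.

Lemma simpleN_inv k : k < n -> (simpleN n k)^-1 = simpleN n k.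
Proof. by move/simpleN_sq/mulg1_eq. Qed.

Lemma refl_at_simple k : refl_at n (simple_label k) = simpleN n k.
Proof. exact: type_D_lift_simple. Qed.

Lemma refl_at_comm x y : label_wf M x -> label_wf M y -> label_comm x y ->
  commute (refl_at n x) (refl_at n y).
Proof. exact/type_D_lift_comm/respects_simpleD. Qed.

Lemma refl_at_triangle x y z : label_triangle x y z ->
  label_wf M x -> label_wf M y -> label_wf M z ->
  dual_triangle (refl_at n x) (refl_at n y) (refl_at n z).
Proof. exact/type_D_lift_triangle/respects_simpleD. Qed.

Lemma spoke_refl_comm k e : 0 < k <= M ->
  commute (spoke_refl k e) (spoke_refl k (~~ e)).
Proof.
move=> kM; case: e; [|apply: commute_sym]; apply: refl_at_comm;
  by rewrite /label_wf /label_comm /=; lia.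
Qed.

Lemma spoke_refl_conj_band i k e : 0 < i -> i < M -> 0 < k <= M ->
  spoke_refl k e ^ simpleN n i.+1 =
  spoke_refl (if k == i then i.+1 else if k == i.+1 then i else k) e.
Proof.
move=> i0 iM kM; have iV : (simpleN n i.+1)^-1 = simpleN n i.+1.
  by apply: simpleN_inv; rewrite /M in iM; lia.
have tri : dual_triangle (spoke_refl i e) (spoke_refl i.+1 e) (simpleN n i.+1).
  rewrite -(refl_at_simple i.+1); apply: refl_at_triangle;
    rewrite /label_wf /=; try lia.
  by apply: LabelTriangle1.
have up : spoke_refl i.+1 e = spoke_refl i e ^ simpleN n i.+1.
  by rewrite -iV; exact: dual_triangle_conj (dual_triangle_rot (dual_triangle_rot tri)).
have [->|ki] := eqVneq k i; first by rewrite up.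
have [->|ki1] := eqVneq k i.+1.
  by rewrite up -conjgM -{1}iV mulVg conjg1.
apply: conjg_commute; rewrite -(refl_at_simple i.+1); apply: refl_at_comm;
  by rewrite /label_wf /label_comm /=; lia.
Qed.

(** The product [s_1 s_0] negates [e_0] and [e_1]. This exchanges [e_k + e_0] and [e_k - e_0] for
    [k] other than 1, and for [k = 1] only changes the sign of each root. *)
Lemma spoke_refl_conj_fork k e : 0 < k <= M ->
  spoke_refl k e ^ (simpleN n 1 * simpleN n 0) =
  spoke_refl k (if k == 1%N then e else ~~ e).
Proof.
move=> kM; have s1E : simpleN n 1 = spoke_refl 1 false by rewrite -(refl_at_simple 1).
have s0E : simpleN n 0 = spoke_refl 1 true by rewrite -(refl_at_simple 0).
have c10 : simpleN n 1 * simpleN n 0 = spoke_refl 1 (~~ e) * spoke_refl 1 e.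
  have c := @spoke_refl_comm 1 true; rewrite s1E s0E.
  by case: e => //=; rewrite c //; rewrite /M; lia.
have [k1|k1] := eqVneq k 1%N.
  rewrite c10 k1 conjgM (conjg_commute (spoke_refl_comm _ _)); last by rewrite /M; lia.
  exact/conjg_commute/commute_refl.
have eV : (spoke_refl 1 e)^-1 = spoke_refl 1 e.
  by case: e {c10}; rewrite -?s1E -?s0E simpleN_inv //; lia.
rewrite c10 conjgM.
(* The conjugation is done in two steps through the root [e_k + e_1]: one spoke at 1 leads to it,
   and the other leads from it to the opposite spoke at [k]. *)
have t1 : dual_triangle (spoke_refl k e) (spoke_refl 1 (~~ e))
    (refl_at n (1%N, k, true)).
  apply: refl_at_triangle; rewrite /label_wf /= /M; try lia.
  by apply: LabelTriangle2; lia.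
have t2 : dual_triangle (spoke_refl k (~~ e)) (spoke_refl 1 e)
    (refl_at n (1%N, k, true)).
  apply: refl_at_triangle; rewrite /label_wf /= /M; try lia.
  by rewrite -{2}(negbK e); apply: LabelTriangle2; lia.
rewrite -(dual_triangle_conjV t1) (dual_triangle_conj (dual_triangle_rot t2)).
by rewrite eV.
Qed.

Lemma simpleF_inv (i : 'I_n.-1) : (simpleF i)^-1 = simpleF i.
Proof.
rewrite simpleF_fiber //; have := @fiber_commute n W (@simpleD n) i.
rewrite /fiber; case: eqP => [_ c|_ _].
  rewrite !big_cons big_nil /= mulg1 invgM !simpleN_inv; [|lia..].
  by apply: c; rewrite ?inE //; exact: respects_simpleD.
by rewrite big_seq1 simpleN_inv //; have := ltn_ord i; lia.
Qed.

Lemma spoke_refl_conj (i : 'I_n.-1) k : 0 < k <= M ->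
  exists k' d, 0 < k' <= M /\
    forall e, spoke_refl k e ^ simpleF i = spoke_refl k' (e (+) d).
Proof.
move=> kM; have iM := ltn_ord i; have [i0|i0] := posnP i.
  exists k, (k != 1%N); split=> // e; rewrite simpleF_fiber // /fiber i0 /=.
  rewrite !big_cons big_nil mulg1 spoke_refl_conj_fork //.
  by case: eqP => _ /=; rewrite ?addbF ?addbT.
exists (if k == i then i.+1 else if k == i.+1 then i : nat else k), false; split.
  by rewrite /M in kM *; case: ifP => _; [lia | case: ifP => _; lia].
move=> e; rewrite simpleF_fiber // /fiber (gtn_eqF i0) big_seq1 addbF.
exact: spoke_refl_conj_band.
Qed.

(** The flip [d] does not depend on [e], so the two spokes at [k] go together to the two spokes at
    [k']: these pairs are the two-element orbits. *)
Lemma spoke_refl_generated w k : Defs.generated (@simpleF n) w -> 0 < k <= M ->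
  exists k' d, 0 < k' <= M /\
    forall e, spoke_refl k e ^ w^-1 = spoke_refl k' (e (+) d).
Proof.
case=> u _ <- {w} kM; elim: u => [|[i b] u [k' [d [k'M IH]]]].
  exists k, false; split=> // e.
  by rewrite /weval big_nil invg1 conjg1 addbF.
have [k'' [d' [k''M cE]]] := spoke_refl_conj i k'M.
exists k'', (d (+) d'); split=> // e.
rewrite /weval big_cons -/(weval _ _) invgM conjgM IH addbA -cE.
by case: b; rewrite /= ?invgK ?simpleF_inv.
Qed.

(** The sign character of [W]. It tells the two kinds of generators of [W^f] apart: [s_0 s_1] is
    even, the others are odd. *)
Definition sign_of : W -> {perm bool} := pres_map (fun _ : 'I_n => tperm false true).

Lemma respects_sign :
  respects_rel (cox_rel (@Dmat n)) (fun _ : 'I_n => tperm false true).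
Proof.
move=> _ _ [i [j [-> ->]]]; elim: (Dmat i j) => //= k <-.
by rewrite /weval !big_cons mulgA tperm2 mul1g.
Qed.

Lemma sign_of_M : {morph sign_of : x y / x * y}.
Proof. exact/pres_mapM/respects_sign. Qed.

Lemma sign_of_simpleF (i : 'I_n.-1) : (sign_of (simpleF i) == 1) = (i == 0 :> nat).
Proof.
have sN k : k < n -> sign_of (simpleN n k) = tperm false true.
  move=> kn; rewrite /simpleN -[k]/(val (Ordinal kn)) extend_ord.
  exact: (pres_map_gen respects_sign).
rewrite simpleF_fiber // /fiber; have [i0|i0] := eqVneq (i : nat) 0.
  by rewrite !big_cons big_nil mulg1 sign_of_M !sN ?tperm2 ?eqxx //; lia.
rewrite big_seq1 sN; last by have := ltn_ord i; lia.
by apply/eqP => /permP /(_ false); rewrite tpermL perm1.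
Qed.

Definition spoke_pair (k : nat) : W := spoke_refl k true * spoke_refl k false.

Lemma spoke_pairE k e : 0 < k <= M ->
  spoke_refl k e * spoke_refl k (~~ e) = spoke_pair k.
Proof. by move=> kM; case: e => //; exact: spoke_refl_comm. Qed.

(** The product of the two spokes at [k] negates [e_0] and [e_k] and fixes the other coordinates, so
    [k] can be recovered from it. *)
Lemma spoke_pair_inj k l : 0 < k <= M -> 0 < l <= M ->
  spoke_pair k = spoke_pair l -> k = l.
Proof.
move=> kM lM /(congr1 (@signed_perm n)).
have wf a s : 0 < a <= M -> label_wf M (0, a, s) by [].
rewrite !(signed_perm_M n3) !signed_perm_refl_at ?wf //.
have eval a : 0 < a <= M ->
    (label_perm M (0, a, true) * label_perm M (0, a, false)) (pt M k true) =
    pt M k (a != k).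
  move=> aM; rewrite permM /label_perm /=.
  have [->|ak] := eqVneq a k; last first.
    by rewrite [refl2 _ _ _]refl2D ?refl2D //; apply: pt_neq; lia.
  rewrite refl2L; last by apply: pt_neq; lia.
  rewrite -[pt M 0 false]/(neg (pt M 0 true)) refl2_neg; last by apply: pt_neq; lia.
  by rewrite refl2R //; apply: pt_neq; lia.
move/permP/(_ (pt M k true)); rewrite !eval // eqxx => -[].
by case: eqVneq.
Qed.

Lemma simpleF_pair (i : 'I_n.-1) : i = 0 :> nat -> simpleF i = spoke_pair 1.
Proof.
move=> i0; rewrite simpleF_fiber // /fiber i0 !big_cons big_nil mulg1.
rewrite -(@spoke_pairE 1 false); last by rewrite /M; lia.
by rewrite -(refl_at_simple 1) -(refl_at_simple 0).
Qed.

Lemma simpleN_spoke k : k < 2 -> simpleN n k = spoke_refl 1 (k == 0).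
Proof. by case: k => [|[|]] // _; rewrite -refl_at_simple. Qed.

(** The sign character shows that all expressions of the reflection have orbits of the same size. A
    one-element orbit is the reflection itself. Otherwise the reflection is some [spoke_pair k],
    which determines [k], and every expression yields both spokes at [k]. *)
Lemma orb_theta_entry w (i : 'I_n.-1) : Defs.generated (@simpleF n) w ->
  orb_theta (w * simpleF i * w^-1) =
  [set t | t \in [seq simpleN n k ^ w^-1 | k <- fiber i]]%classic.
Proof.
move=> gw; apply/seteqP; split=> t /=.
  case=> w' [i' [gw' e [j]]]; rewrite fiber_theta => jO ->.
  have ii' : (i == 0 :> nat) = (i' == 0 :> nat).
    rewrite -!sign_of_simpleF.
    move/(congr1 sign_of): e; rewrite !sign_of_M !(morph_inv sign_of_M).
    move=> e; apply/eqP/eqP => h; move: e; rewrite h mulg1 mulgV.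
      by move/esym/(canRL (mulgVK _)); rewrite mul1g => /(canRL (mulKg _)); rewrite mulVg.
    by move/(canRL (mulgVK _)); rewrite mul1g => /(canRL (mulKg _)); rewrite mulVg.
  have conjV (x y : W) : x * y * x^-1 = y ^ x^-1 by rewrite conjgE invgK mulgA.
  rewrite conjV; move: e; rewrite !conjV.
  have sj : simpleD j = simpleN n j by rewrite /simpleN extend_ord.
  have [i0|i0] := eqVneq (i : nat) 0; last first.
    move: jO; rewrite /fiber (negbTE i0) -ii' (negbTE i0) inE => /eqP jE e.
    have si (l : 'I_n.-1) : l != 0 :> nat -> simpleF l = simpleN n l.+1.
      by move=> l0; rewrite simpleF_fiber // /fiber (negbTE l0) big_seq1.
    by rewrite inE sj jE -(si i') -?ii' // -e si.
  have i'0 : i' = 0 :> nat by apply/eqP; rewrite -ii' i0.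
  rewrite (simpleF_pair i0) (simpleF_pair i'0).
  have M1 : 0 < 1 <= M by rewrite /M; lia.
  have [k [d [kM ck]]] := spoke_refl_generated gw M1.
  have [k' [d' [kM' ck']]] := spoke_refl_generated gw' M1.
  rewrite /spoke_pair !conjMg !ck !ck' !addTb !addFb.
  rewrite -{2}(negbK d) -{2}(negbK d') !spoke_pairE // => /spoke_pair_inj kk'.
  have {}kk' : k = k' by exact: kk'.
  move: jO; rewrite /fiber i'0 i0 /= !inE => jO.
  have j2 : j < 2 by case/orP: jO => /eqP ->.
  rewrite sj (simpleN_spoke j2) ck' -kk' !simpleN_spoke // !ck /=.
  by case: (nat_of_ord j == 0); case: d {ck}; case: d' {ck'}; rewrite eqxx ?orbT.
case/mapP => k kO ->; exists w, i; split=> //.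
exists (Ordinal (fiber_lt n3 (ltn_ord i) kO)); first by rewrite fiber_theta.
rewrite conjgE invgK mulgA; congr (_ * _ * _).
by rewrite /simpleN -[k in LHS]/(val (Ordinal (fiber_lt n3 (ltn_ord i) kO))) extend_ord.
Qed.

Lemma simpleN_fiber_uniq (i : 'I_n.-1) (w : W) :
  uniq [seq simpleN n k ^ w | k <- fiber i].
Proof.
rewrite /fiber; case: eqP => //= _; rewrite inE andbT.
rewrite (inj_eq (@conjg_inj _ w)) !simpleN_spoke //.
apply/eqP => e; suff : (0, 1%N, 1%N == 0) = (0, 1%N, 0 == 0) :> label by [].
by apply: (refl_at_inj n3) e; rewrite /label_wf /=; lia.
Qed.

End FoldedReflections.

(** * Exponent sum *)

Section ExponentSum.
Variables (I : choiceType) (m : I -> I -> nat).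

Definition word_weight (w : word I) : int :=
  (\sum_(x <- w) (if x.2 then -1 else 1 : int))%R.

Lemma word_weight_cat u v : word_weight (u ++ v) = (word_weight u + word_weight v)%R.
Proof. exact: big_cat. Qed.

Lemma word_weight_pos w : word_weight (pos_word w) = Posz (size w).
Proof.
elim: w => [|i w IHw]; first by rewrite /word_weight big_nil.
by rewrite /word_weight /= big_cons -/(word_weight _) IHw /=; lia.
Qed.

Lemma size_alt k (i j : I) : size (alt k i j) = k.
Proof. by elim: k i j => //= k IHk i j; rewrite IHk. Qed.

(** A braid relation equates positive words of equal length. *)
Lemma word_weight_eq u v : pres_eq (braid_rel m) u v -> word_weight u = word_weight v.
Proof.
elim=> {u v} [//|u v _ -> //|u v w _ -> //|u u' v v' _ + _ +|i b|u v [i [j [-> ->]]]].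
- by rewrite !word_weight_cat => -> ->.
- by rewrite /word_weight !big_cons big_nil; case: b => /=; lia.
- by rewrite !word_weight_pos !size_alt.
Qed.

Definition exponent_sum (x : braid_group m) : int := word_weight (repr x).

Lemma exponent_sum_pi u : exponent_sum (\pi_(braid_group m) u)%qT = word_weight u.
Proof. exact/word_weight_eq/pres_repr. Qed.

Lemma exponent_sumM x y :
  exponent_sum (x * y) = (exponent_sum x + exponent_sum y)%R.
Proof.
elim/quotW: x => u; elim/quotW: y => v; rewrite [(_ * _)%g]pres_mulE !exponent_sum_pi.
exact: word_weight_cat.
Qed.

Lemma exponent_sum_gen i : exponent_sum (artin_gen m i) = 1%R.
Proof. by rewrite exponent_sum_pi /word_weight big_seq1. Qed.

Lemma exponent_sum1 : exponent_sum 1 = 0%R.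
Proof. by have := exponent_sumM 1 1; rewrite mulg1; lia. Qed.

Lemma exponent_sumV x : exponent_sum x^-1 = (- exponent_sum x)%R.
Proof. by have := exponent_sumM x x^-1; rewrite mulgV exponent_sum1; lia. Qed.

Lemma exponent_sumJ x y : exponent_sum (x ^ y) = exponent_sum x.
Proof. by rewrite conjgE !exponent_sumM exponent_sumV; lia. Qed.

Lemma exponent_sum_prod (T : eqType) (r : seq T) (F : T -> braid_group m) (d : nat) :
  (forall i, i \in r -> exponent_sum (F i) = Posz d) ->
  exponent_sum (\prod_(i <- r) F i) = Posz (d * size r).
Proof.
elim: r => [|i r IHr] Fd; first by rewrite big_nil exponent_sum1 muln0.
rewrite big_cons exponent_sumM IHr => [|j jr]; last by apply: Fd; rewrite inE jr orbT.
by rewrite Fd ?mem_head //= mulnS; lia.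
Qed.

Lemma exponent_sumX x k : exponent_sum (x ^+ k) = (k%:Z * exponent_sum x)%R.
Proof.
elim: k => [|k IHk]; first by rewrite expg0 exponent_sum1; lia.
by rewrite expgS exponent_sumM IHk; lia.
Qed.

End ExponentSum.

Lemma take_flatten_nseq (T : Type) (s : seq T) q m a : q < m -> a <= size s ->
  take (q * size s + a) (flatten (nseq m s)) = flatten (nseq q s) ++ take a s.
Proof.
elim: q m => [|q IHq] [|m] //= qm aS; first by rewrite mul0n add0n takel_cat.
rewrite take_cat mulSn -addnA ltnNge leq_addr /=.
by rewrite addKn IHq // catA.
Qed.

Lemma perm_big_commute (T : eqType) (G : groupType) (r s : seq T) (F : T -> G) :
  {in r &, forall x y, commute (F x) (F y)} -> perm_eq r s ->
  \prod_(t <- r) F t = \prod_(t <- s) F t.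
Proof.
elim: r s => [|a r IHr] s Fc rs.
  by rewrite perm_sym in rs; rewrite (perm_nilP rs).
have as_ : a \in s by rewrite -(perm_mem rs) mem_head.
case/splitPr: as_ rs => p1 p2.
rewrite perm_sym perm_catC /= perm_cons perm_catC perm_sym => rs.
rewrite big_cons (IHr _ _ rs) => [|x y xr yr]; last first.
  by apply: Fc; rewrite inE ?xr ?yr orbT.
rewrite !big_cat big_cons /= !mulgA; congr (_ * _).
rewrite big_seq; apply: commute_prod => x xp1; apply: Fc; rewrite inE ?eqxx //.
by rewrite (perm_mem rs) mem_cat xp1 orbT.
Qed.

(** The product over a set runs through the finite support of [F], in an unspecified order and
    without the [t] such that [F t = 1]. Commutation absorbs the order, and the omitted factors are
    trivial. *)
Lemma big_set_seq (T : choiceType) (G : groupType) (s : seq T) (F : T -> G) :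
  uniq s -> {in s &, forall x y, commute (F x) (F y)} ->
  \big[*%g/1]_(t \in [set t | t \in s]%classic) F t = \prod_(t <- s) F t.
Proof.
move=> us Fc; set A := [set t | t \in s]%classic.
set r := finite_support _ _ _.
have finA : finite_set (A `&` F @^-1` [set~ 1%g])%classic.
  apply: (@sub_finite_set _ _ [set` s]%classic); last exact: finite_seq.
  by move=> t [].
have memr t : (t \in r) = (F t != 1) && (t \in s).
  rewrite in_finite_support //; apply/idP/andP; first by move/set_mem => [ts /eqP Ft].
  by case=> /eqP Ft ts; apply/mem_set.
have -> : \prod_(t <- s) F t = \prod_(t <- [seq t <- s | F t != 1]) F t.
  by rewrite big_filter [RHS]big_mkcond; apply: eq_bigr => t _; case: eqP.
apply: perm_big_commute.
  by move=> x y; rewrite !memr => /andP[_ xs] /andP[_ ys]; exact: Fc.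
apply: uniq_perm; [exact: finite_support_uniq | exact: filter_uniq |].
by move=> t; rewrite memr mem_filter.
Qed.

(** * The image under [iota_fold] of the factors attached to grid cells *)

Section FoldedCells.
Variable n : nat.
Hypothesis n3 : 2 < n.

Lemma iota_BcF : iota_fold (BcF n) = BcD n.
Proof.
rewrite /BcF /BcD /braid_cox (morph_prod (@iota_foldM n)).
rewrite (eq_bigr (fun i : 'I_n.-1 => \prod_(k <- fiber i) artinD n k)) => [|i _];
  last exact: iota_fold_fiber.
transitivity (\prod_(k <- rev (iota 0 n)) artinD n k).
  rewrite -cF_fiber //; elim: (cF n) => [|i r IHr]; first by rewrite !big_nil.
  by rewrite big_cons /= big_cat IHr.
rewrite /cD -val_enum_ord -map_rev big_map; apply: eq_bigr => i _.
exact: extend_ord.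
Qed.

Lemma generated_projB (x : braid_group (@Bmat n.-1)) :
  Defs.generated (@simpleF n) (projB x).
Proof. by exists (repr x). Qed.

Lemma generated_projD (x : braid_group (@Dmat n)) :
  Defs.generated (@simpleD n) (projD x).
Proof. by exists (repr x). Qed.

(** A prefix of length [q * n.-1 + a] of the repeated word is [q] copies of [cF] followed by a
    prefix of [cF]. Hence the grid reflection is the projection of the entry given by
    [hurwitz_prefix_entry]. *)
Lemma grid_entry q a : q < n.-1 -> a < n.-1 ->
  exists tup b, [/\ hurwitz_equiv [seq artin_gen (@Bmat n.-1) i | i <- cF n] tup,
    b \in tup & projB b = grid_refl n (q * n.-1 + a.+1)].
Proof.
move=> qn an; have sF : size (cF n) = n.-1 by rewrite /cF size_rev size_enum_ord.
pose x0 : 'I_n.-1 := Ordinal an; set x := nth x0 (cF n) a.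
have aF : a < size (cF n) by rewrite sF.
have [tup ht bt] := hurwitz_prefix_entry
  [seq artin_gen (@Bmat n.-1) i | i <- take a (cF n)] (artin_gen (@Bmat n.-1) x)
  [seq artin_gen (@Bmat n.-1) i | i <- drop a.+1 (cF n)] q.
have cE : [seq artin_gen (@Bmat n.-1) i | i <- cF n] =
  [seq artin_gen (@Bmat n.-1) i | i <- take a (cF n)] ++ artin_gen (@Bmat n.-1) x ::
  [seq artin_gen (@Bmat n.-1) i | i <- drop a.+1 (cF n)].
  by rewrite -map_cons -map_cat -drop_nth // cat_take_drop.
move: ht bt; rewrite -cE !big_map => ht bt.
eexists tup, _; split; [exact: ht | exact: bt|].
rewrite (morph_conj (@projB_M n)) (morph_inv (@projB_M n)) projB_M.
rewrite (morph_exp (@projB_M n)).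
rewrite !(morph_prod (@projB_M n)) projB_gen.
have take_u b : b <= n.-1 -> take (q * n.-1 + b) (flatten (nseq n.-1 (cF n))) =
    flatten (nseq q (cF n)) ++ take b (cF n).
  by move=> bn; have := @take_flatten_nseq _ (cF n) q n.-1 b qn; rewrite sF; exact.
set P := (X in _ ^ X^-1).
have PE : P = \prod_(i <- take (q * n.-1 + a) (flatten (nseq n.-1 (cF n)))) simpleF i.
  rewrite take_u ?(ltnW an) // big_cat; congr (_ * _);
    last by apply: eq_bigr => i _; exact: projB_gen.
  elim: q {qn bt take_u P} => [|q IHq]; first by rewrite big_nil.
  rewrite expgS /= big_cat IHq; congr (_ * _).
  by apply: eq_bigr => i _; exact: projB_gen.
have rev_inv (s : seq 'I_n.-1) :
    \prod_(i <- rev s) simpleF i = (\prod_(i <- s) simpleF i)^-1.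
  elim: s => [|i s IHs]; first by rewrite !big_nil invg1.
  by rewrite rev_cons big_rcons big_cons /= IHs invgM simpleF_inv.
(* The generators [simpleF i] are involutions, so the reversed prefix in [grid_refl] is the inverse
   of the prefix. *)
rewrite /grid_refl addnS /= big_cat rev_inv -PE conjgE invgK mulgA; congr (_ * _).
have -> : take (q * n.-1 + a).+1 (flatten (nseq n.-1 (cF n))) =
    rcons (take (q * n.-1 + a) (flatten (nseq n.-1 (cF n)))) x.
  rewrite -addnS !take_u //; last exact: ltnW.
  by rewrite rcons_cat (take_nth x0).
by rewrite big_rcons /= -PE.
Qed.

Lemma block_commute (x : braid_group (@Bmat n.-1) * 'I_n.-1) :
  {in block x &, forall y z, commute y z}.
Proof.
move=> _ _ /mapP[k kO ->] /mapP[l lO ->]; apply: commute_conj.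
by apply: fiber_commute kO lO; exact: respects_gen.
Qed.

Lemma prod_block_sq (x : braid_group (@Bmat n.-1) * 'I_n.-1) :
  (\prod_(y <- block x) y) ^+ 2 = \prod_(y <- block x) y ^+ 2.
Proof.
have := block_commute (x := x); rewrite /block /fiber; case: eqP => _ /= c.
  rewrite !big_cons !big_nil !mulg1 expgMn //.
  by apply: c; rewrite !inE eqxx ?orbT.
by rewrite !big_seq1.
Qed.

(** The chosen type B lift is some [entryB x], and [block x] lies inside a tuple of the type D
    orbit, so each of its factors is the dual lift of its own projection. As the factors commute,
    the square of their product is the product of their squares. *)
Lemma cell_fold t tup b :
  hurwitz_equiv [seq artin_gen (@Bmat n.-1) i | i <- cF n] tup ->
  b \in tup -> projB b = t ->
  exists us, [/\ forall u, u \in us -> reflection (@simpleD n) u,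
    forall u, u \in us -> exponent_sum (PcD u) = Posz 2,
    iota_fold (PcF t) = \prod_(u <- us) PcD u &
    \big[*%g/1]_(u \in orb_theta t) PcD u = \prod_(u <- us) PcD u].
Proof.
move=> ht bt pbt.
have [] := @xgetPex _ 1 [set b : braid_group (@Bmat n.-1) |
    Defs.proj (@simpleF n) b = t /\ exists2 tup,
    hurwitz_equiv [seq artin_gen (@Bmat n.-1) i | i <- cF n] tup & b \in tup]%classic.
  by exists b; split=> //; exists tup.
rewrite -/(dual_lift (@Bmat n.-1) (@simpleF n) (cF n) t).
set b0 := dual_lift _ _ _ t => pb0 [tup0 ht0 bt0].
have [L [tupE htD]] := hurwitz_fold n3 ht0.
move: bt0; rewrite tupE => /mapP[x xL b0E].
have entry y : y \in block x -> y \in flatten [seq block z | z <- L].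
  by move=> yx; apply/flattenP; exists (block x) => //; exact: map_f.
have PcDE y : y \in block x -> PcD (projD y) = y ^+ 2.
  by move=> yx; rewrite /PcD /dual_pure (dual_lift_entry n3 htD (entry _ yx)).
pose us := [seq projD y | y <- block x].
have usE : us = [seq simpleN n k ^ (projB x.1)^-1 | k <- fiber x.2].
  rewrite /us /block -map_comp; apply: eq_map => k /=.
  by rewrite (morph_conj (@projD_M n)) (morph_inv (@projD_M n)) projDE proj_iota_fold.
have iotaE : iota_fold (PcF t) = \prod_(u <- us) PcD u.
  rewrite /PcF /dual_pure -/b0 (morph_exp (@iota_foldM n)) b0E -block_prod prod_block_sq.
  by rewrite /us [RHS]big_map; apply: eq_big_seq => y /PcDE ->.
exists us; split=> //.
- rewrite usE => u /mapP[k kO ->].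
  exists (projB x.1), (Ordinal (fiber_lt n3 (ltn_ord x.2) kO)); split.
    by rewrite -proj_iota_fold; exact: generated_projD.
  rewrite conjgE invgK mulgA; congr (_ * _ * _).
  by rewrite /simpleN -[k in LHS]/(val (Ordinal (fiber_lt n3 (ltn_ord x.2) kO)))
     extend_ord.
- move=> _ /mapP[y yx ->]; rewrite PcDE // exponent_sumX.
  case/mapP: yx => k kO ->; rewrite exponent_sumJ /artinD.
  rewrite -[k]/(val (Ordinal (fiber_lt n3 (ltn_ord x.2) kO))) extend_ord.
  by rewrite exponent_sum_gen.
have -> : orb_theta t = [set u | u \in us]%classic.
  rewrite usE -orb_theta_entry //; last exact: generated_projB.
  rewrite -pb0 b0E -[Defs.proj _ _]/(projB _) /entryB (morph_conj (@projB_M n)).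
  by rewrite (morph_inv (@projB_M n)) projB_gen conjgE invgK mulgA.
apply: big_set_seq.
- by rewrite usE; exact: simpleN_fiber_uniq.
move=> _ _ /mapP[y yx ->] /mapP[z zx ->]; rewrite !PcDE //.
exact/commuteX2/(block_commute yx zx).
Qed.

Lemma cell_bounds p ab : ab \in cells n.-1 p -> 0 < ab.1 <= n.-1 /\ 0 < ab.2 <= n.-1.
Proof.
rewrite mem_filter => /andP[_ /allpairsP[[b a] /= [bn an ->]]] /=.
by move: an bn; rewrite !mem_rev !mem_iota !add1n !ltnS.
Qed.

Lemma cells_fold (cs : seq (nat * nat)) :
  (forall ab, ab \in cs -> 0 < ab.1 <= n.-1 /\ 0 < ab.2 <= n.-1) ->
  exists us, [/\ forall u, u \in us -> reflection (@simpleD n) u,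
    forall u, u \in us -> exponent_sum (PcD u) = Posz 2,
    iota_fold (\prod_(ab <- cs) PcF (cell_refl n ab)) = \prod_(u <- us) PcD u &
    iota_fold (\prod_(ab <- cs) PcF (cell_refl n ab)) =
      \prod_(ab <- cs) \big[*%g/1]_(t \in orb_theta (cell_refl n ab)) PcD t].
Proof.
elim: cs => [|[a b] cs IHcs] csP.
  by exists [::]; rewrite !big_nil (morph_one (@iota_foldM n)); split.
have [] := csP _ (mem_head _ _); rewrite /= => an bn.
have [|us [us_refl us_sum usE bigE]] := IHcs.
  by move=> ab abc; apply: csP; rewrite inE abc orbT.
(* Cells are numbered from 1, while [grid_entry] counts turns and letters from 0. *)
have [||tup [g [ht gt pg]]] := @grid_entry b.-1 a.-1; [lia | lia |].
rewrite prednK in pg; last by case/andP: an.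
have [vs [vs_refl vs_sum vsE orbE]] := cell_fold ht gt pg.
exists (vs ++ us); split.
- by move=> u; rewrite mem_cat => /orP[/vs_refl|/us_refl].
- by move=> u; rewrite mem_cat => /orP[/vs_sum|/us_sum].
- by rewrite big_cons iota_foldM big_cat -usE -vsE.
- by rewrite !big_cons iota_foldM bigE vsE -orbE.
Qed.

End FoldedCells.

Theorem corollary7p18 (n p : nat)
    (n_ge3 : (3 <= n)%N)
    (p_coprime : coprime p (2 * n - 2)%N)
    (p_range : (1 <= p < 2 * n - 2)%N)
    (gf : braid_group (@Bmat n.-1))
    (gf_conj : is_conjugator (@simpleF n) (cF n) p gf)
    (gf_eq : gf * BcF n ^+ p * gf^-1 * (BcF n)^-1 =
             \prod_(ab <- cells n.-1 p) PcF (cell_refl n ab)) :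
  let g := iota_fold gf in
  is_positive_dual_conjugator (@simpleD n) (cD n) p g /\
  g * BcD n ^+ p * g^-1 * (BcD n)^-1 =
    iota_fold (gf * BcF n ^+ p * gf^-1 * (BcF n)^-1) /\
  iota_fold (gf * BcF n ^+ p * gf^-1 * (BcF n)^-1) =
    \prod_(ab <- cells n.-1 p)
      \big[*%g/1]_(t \in orb_theta (cell_refl n ab)) PcD t.
Proof.
move=> g; have [us [us_refl us_sum usE orbE]] := cells_fold n_ge3 (@cell_bounds n p).
have gE : g * BcD n ^+ p * g^-1 * (BcD n)^-1 =
    iota_fold (gf * BcF n ^+ p * gf^-1 * (BcF n)^-1).
  rewrite !iota_foldM !(morph_inv (@iota_foldM n)) (morph_exp (@iota_foldM n)).
  by rewrite (iota_BcF n_ge3).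
split; last by split=> //; rewrite gf_eq orbE.
split.
  (* The two Coxeter elements are the projections of [BcD] and [BcF], and [iota_fold] sends [BcF] to
     [BcD] compatibly with the projections. So [c^f = c] in [W], and the conjugator condition
     carries over. *)
  have coxD : cox_elt (@simpleD n) (cD n) = projD (BcD n).
    rewrite /BcD /braid_cox (morph_prod (@projD_M n)).
    by apply: eq_bigr => i _; rewrite /projD projD_gen.
  have coxF : cox_elt (@simpleF n) (cF n) = projB (BcF n).
    rewrite /BcF /braid_cox (morph_prod (@projB_M n)).
    by apply: eq_bigr => i _; rewrite projB_gen.
  have := gf_conj; rewrite /is_conjugator coxF coxD -!proj_iota_fold (iota_BcF n_ge3).
  by rewrite -[Defs.proj _ gf]/(projB gf) -proj_iota_fold.
exists us; have defectE : conj_defect (cD n) p g = \prod_(u <- us) PcD u.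
  by rewrite -usE -gf_eq -gE.
(* The braid [BcD] has exponent sum [n], so the defect has exponent sum [n p - n]; each factor
   [PcD u] contributes 2. Comparison gives [2 * size us = n * p.-1]. *)
split=> //; have := congr1 (@exponent_sum _ _) defectE.
rewrite (exponent_sum_prod us_sum) /conj_defect !exponent_sumM !exponent_sumV.
rewrite exponent_sumX.
rewrite /braid_cox (@exponent_sum_prod _ _ _ (cD n) _ 1%N);
  last by move=> i _; exact: exponent_sum_gen.
rewrite card_ord /cD size_rev size_enum_ord mul1n.
have [q pE] : exists q, p = q.+1 by exists p.-1; lia.
by rewrite pE /=; lia.
Qed.
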